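(* Let $G$ be a Lie group with Lie algebra $\mathfrak g$, endowed with a left-invariant proper locally conformally pseudo-Kähler structure $(\omega,J)$ with Lee form $\lambda$. (i) Suppose $\mathfrak g$ admits a bi-invariant (i.e. $\mathrm{ad}$-invariant, possibly indefinite, non-degenerate) scalar product $B$ such that the vector $B^{-1}\lambda\in\mathfrak g$ is non-isotropic. Let $\phi\in\mathfrak g^*$ satisfy $\omega=-\lambda\wedge\phi+d\phi$ and let $v\in\mathfrak g$ be the vector with $\phi=B(v,\cdot)$. Then the centralizer of $v$ in $\mathfrak g$ has dimension at most $2$. (ii) Suppose $\mathfrak g$ is reductive. Then $\mathfrak g\cong\mathfrak u(2)$ or $\mathfrak g\cong\mathfrak{gl}(2,\mathbb R)$, and $(\omega,J)$ is one of the following structures. (a) If $\mathfrak g\cong\mathfrak u(2)$: there is a basis $(e_0,e_1,e_2,e_3)$ of $\mathfrak g$ with dual basis $(e^0,e^1,e^2,e^3)$ such that $e_0$ is central, $[e_\alpha,e_\beta]=-e_\gamma$ for every cyclic permutation $(\alpha,\beta,\gamma)$ of $(1,2,3)$, $\lambda=-e^0$, and $J=J_{a,b}$ for some $a\in\mathbb R$, $b\in\mathbb R\setminus\{0\}$, where, with $c=-\frac{1+a^2}{b}$, $$J_{a,b}e_0=ae_0+be_1,\quad J_{a,b}e_1=ce_0-ae_1,\quad J_{a,b}e_2=-e_3,\quad J_{a,b}e_3=e_2,$$ and either $\omega=s(e^0\wedge e^1+e^2\wedge e^3)$ for some $s\in\mathbb R\setminus\{0\}$, or $(a,b)=(0,1)$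 and $\omega=e^0\wedge\phi+d\phi$ for some nonzero $\phi\in\mathrm{span}\{e^1,e^2,e^3\}$. (b) If $\mathfrak g\cong\mathfrak{gl}(2,\mathbb R)$: there is a basis $(e_0,h,e_+,e_-)$ of $\mathfrak g$ with dual basis $(e^0,h^*,e^+,e^-)$ such that $e_0$ is central, $[h,e_\pm]=\pm2e_\pm$, $[e_+,e_-]=h$, $\lambda=-e^0$, and $J=J_\mu$ for some $\mu=\mu_1+i\mu_2\in\mathbb C\setminus i\mathbb R$, where $$J_\mu e_0=\tfrac{\mu_2}{\mu_1}e_0-\tfrac{|\mu|^2}{2\mu_1}(e_+-e_-),\quad J_\mu h=e_++e_-,\quad J_\mu e_\pm=\pm\tfrac1{\mu_1}e_0\mp\tfrac{\mu_2}{2\mu_1}(e_+-e_-)-\tfrac12h,$$ and either $\omega=s\big(e^0\wedge(e^+-e^-)-2h^*\wedge(e^++e^-)\big)$ for some $s\in\mathbb R\setminus\{0\}$, or $\mu=1$ and $\omega=e^0\wedge\phi+d\phi$ for some $\phi=a_hh^*+a_+e^++a_-e^-$ with $a_h^2+4a_+a_-\neq0$. Moreover, both for $\mathfrak g=\mathfrak u(2)$ and for $\mathfrak g=\mathfrak{gl}(2,\mathbb R)$ there exist left-invariant proper locally conformally pseudo-Kähler structures that are not of Vaisman type, and for $\mathfrak g=\mathfrak{gl}(2,\mathbb R)$ there even exist such structures not of Vaisman type with positive definite metric.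
   Context: A locally conformally symplectic (lcs) structure is a non-degenerate $2$-form $\omega$ with $d\omega=\lambda\wedge\omega$ for a closed $1$-form $\lambda$ (the Lee form); it is proper if $d\omega\ne0$. A locally conformally pseudo-Kähler structure $(\omega,J)$ is an lcs form $\omega$ together with an integrable complex structure $J$ that is skew-symmetric with respect to $\omega$, so that $g=\omega(\cdot,J\cdot)$ is a (possibly indefinite) pseudo-Riemannian metric. Its Lee field $\xi$ is defined by $g(\xi,\cdot)=-\frac12\lambda$. The (proper) structure is of Vaisman type if $\xi$ is parallel for the Levi-Civita connection of $g$. Left-invariant tensors on $G$ are identified with tensors on $\mathfrak g$, and $d$ is the Chevalley–Eilenberg differential, $d\alpha(X,Y)=-\alpha([X,Y])$ for $\alpha\in\mathfrak g^*$. $B^{-1}\lambda$ denotes the vector with $B(B^{-1}\lambda,\cdot)=\lambda$. Under the assumption of (i) a $1$-form $\phi$ as in (i) exists and is unique up to adding multiples of $\lambda$. *)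

(* Defs.v *)
From HB Require Import structures.
From mathcomp Require Import all_boot all_order all_algebra.
From mathcomp Require Import sesquilinear reals complex ring.

Set Implicit Arguments.
Unset Strict Implicit.
Unset Printing Implicit Defensive.

Import Order.TTheory GRing.Theory Num.Theory.
Local Open Scope ring_scope.

HB.mixin Record isLieAlgebra (R : fieldType) g of Vector R g := {
  lie : g -> g -> g;
  lie_bilinear : bilinear_for *:%R *:%R lie;
  liexx : forall x, lie x x = 0;
  jacobi : forall x y z,
    lie x (lie y z) + lie y (lie z x) + lie z (lie x y) = 0
}.

#[short(type="lieAlgType")]
HB.structure Definition LieAlgebra (R : fieldType) :=
  { g of Vector R g & isLieAlgebra R g }.

HB.instance Definition _ (R : fieldType) (g : lieAlgType R) :=
  bilinear_isBilinear.Build R g g g *:%R *:%R (@lie R g) lie_bilinear.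
HB.instance Definition _ (R : fieldType) (g : lieAlgType R) (x : g) :=
  GRing.isLinear.Build R g g *:%R (lie x) (lie_bilinear.2 x).

Definition lie_isomorphic (R : fieldType) (g h : lieAlgType R) : Prop :=
  exists2 f : 'Hom(g, h),
    bijective f & forall x y, f (lie x y) = lie (f x) (f y).

Definition central (R : fieldType) (g : lieAlgType R) (x : g) : Prop :=
  forall y, lie x y = 0.

Definition centralizer (R : fieldType) (g : lieAlgType R) (v : g) :
  {vspace g} := lker (linfun (lie v)).

Definition lie_ideal (R : fieldType) (g : lieAlgType R) (I : {vspace g}) :
  Prop := forall x y, y \in I -> lie x y \in I.

(* Complete reducibility of the adjoint representation. *)
Definition reductive (R : fieldType) (g : lieAlgType R) : Prop :=
  forall I : {vspace g}, lie_ideal I ->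
  exists2 K : {vspace g},
    lie_ideal K & (I + K = fullv)%VS /\ (I :&: K = 0)%VS.

Definition commutator (R : pzRingType) n (A B : 'M[R]_n) : 'M[R]_n :=
  A *m B - B *m A.

Lemma commutator_bilinear (R : fieldType) n :
  bilinear_for *:%R *:%R (@commutator R n).
Proof.
by split=> C a A B; rewrite /commutator mulmxDl mulmxDr -scalemxAl -scalemxAr;
  rewrite opprD addrACA -scalerBr.
Qed.

Lemma commutatorxx (R : pzRingType) n (A : 'M[R]_n) : commutator A A = 0.
Proof. exact: subrr. Qed.

Lemma commutator_jacobi (R : fieldType) n (A B C : 'M[R]_n) :
  commutator A (commutator B C) + commutator B (commutator C A)
  + commutator C (commutator A B) = 0.
Proof.
rewrite /commutator !mulmxBr !mulmxBl !mulmxA !opprB.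
by apply/matrixP => k l; rewrite !mxE; ring.
Qed.

HB.instance Definition _ (R : fieldType) n :=
  isLieAlgebra.Build R 'M[R]_n (@commutator_bilinear R n)
    (@commutatorxx R n) (@commutator_jacobi R n).

(* u(2) is the real Lie algebra of skew-Hermitian matrices, with R acting
   through the embedding of R in R[i]. *)
Definition skew_hermitian (R : rcfType) n : {pred 'M[R[i]]_n} :=
  [pred A | map_mx conjc A^T == - A].

Fact skew_hermitian_zmod_closed (R : rcfType) n :
  zmod_closed (@skew_hermitian R n).
Proof.
split=> [|A B]; rewrite !inE; first by rewrite trmx0 map_mx0 oppr0.
by move=> /eqP hA /eqP hB; rewrite linearB /= map_mxB hA hB opprD.
Qed.

HB.instance Definition _ (R : rcfType) n :=
  GRing.isZmodClosed.Build 'M[R[i]]_n (@skew_hermitian R n)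
    (@skew_hermitian_zmod_closed R n).

Record u2 (R : rcfType) :=
  U2 { u2_val :> 'M[R[i]]_2; u2_valP : u2_val \in @skew_hermitian R 2 }.

HB.instance Definition _ (R : rcfType) := [isSub of u2 R for @u2_val R].
HB.instance Definition _ (R : rcfType) := [Choice of u2 R by <:].
HB.instance Definition _ (R : rcfType) :=
  [SubChoice_isSubZmodule of u2 R by <:].

Fact skew_hermitianZ (R : rcfType) n (a : R) (A : 'M[R[i]]_n) :
  A \in @skew_hermitian R n -> a%:C%C *: A \in @skew_hermitian R n.
Proof.
rewrite !inE => /eqP hA.
by rewrite linearZ /= map_mxZ hA scalerN /= oppr0.
Qed.

Fact u2_bracket_closed (R : rcfType) n (A B : 'M[R[i]]_n) :
  A \in @skew_hermitian R n -> B \in @skew_hermitian R n ->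
  commutator A B \in @skew_hermitian R n.
Proof.
rewrite !inE => /eqP hA /eqP hB.
rewrite /commutator linearB /= !trmx_mul map_mxB !map_mxM hA hB.
by rewrite !mulNmx !mulmxN !opprK opprB.
Qed.

Definition u2_scale (R : rcfType) (a : R) (A : u2 R) : u2 R :=
  U2 (skew_hermitianZ a (u2_valP A)).

Fact u2_scaleA (R : rcfType) a b (A : u2 R) :
  u2_scale a (u2_scale b A) = u2_scale (a * b) A.
Proof. by apply: val_inj; rewrite /= scalerA rmorphM. Qed.

Fact u2_scale1 (R : rcfType) : left_id 1 (@u2_scale R).
Proof. by move=> A; apply: val_inj; rewrite /= rmorph1 scale1r. Qed.

Fact u2_scaleDr (R : rcfType) : right_distributive (@u2_scale R) +%R.
Proof. by move=> a A B; apply: val_inj; rewrite /= scalerDr. Qed.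

Fact u2_scaleDl (R : rcfType) (A : u2 R) :
  {morph (@u2_scale R)^~ A : a b / a + b}.
Proof. by move=> a b; apply: val_inj; rewrite /= rmorphD scalerDl. Qed.

HB.instance Definition _ (R : rcfType) :=
  GRing.Zmodule_isLmodule.Build R (u2 R)
    (@u2_scaleA R) (@u2_scale1 R) (@u2_scaleDr R) (@u2_scaleDl R).

Definition u2_coords (R : rcfType) (A : u2 R) : 'rV[R]_4 :=
  \row_j [:: complex.Im (u2_val A 0 0); complex.Im (u2_val A 1 1);
             complex.Re (u2_val A 0 1); complex.Im (u2_val A 0 1)]`_j.

Definition u2_matrix (R : rcfType) (w : 'rV[R]_4) : 'M[R[i]]_2 :=
  \matrix_(i, j)
    if i == j then Complex 0 (if i == 0 then w 0 0 else w 0 1)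
    else Complex (if i == 0 then w 0 2 else - w 0 2) (w 0 3).

Fact u2_matrix_skew (R : rcfType) (w : 'rV[R]_4) :
  u2_matrix w \in @skew_hermitian R 2.
Proof.
rewrite inE; apply/eqP/matrixP => i j; rewrite !mxE eq_sym.
by case: i => [[|[|//]] ?]; case: j => [[|[|//]] ?];
  rewrite /= /GRing.opp /= ?oppr0 ?opprK.
Qed.

Fact u2_coords_linear (R : rcfType) : linear (@u2_coords R).
Proof.
move=> a A B; apply/rowP => j; rewrite !mxE.
case: A B => [A hA] [B hB] /=.
case: (A 0 0) (A 1 1) (A 0 1) => [? ?] [? ?] [? ?].
case: (B 0 0) (B 1 1) (B 0 1) => [? ?] [? ?] [? ?].
by case: j => [[|[|[|[|//]]]] ?] /=; rewrite mul0r ?subr0 ?addr0.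
Qed.

Fact u2_coords_bij (R : rcfType) : bijective (@u2_coords R).
Proof.
exists (fun w => U2 (u2_matrix_skew w)) => [A|w]; last first.
  apply/rowP => j; rewrite !mxE /=.
  by case: j => [[|[|[|[|//]]]] ?] /=; congr (w _ _); apply: val_inj.
apply: val_inj; case: A => [A hA] /=.
have /eqP/matrixP hE : map_mx conjc A^T == - A by exact: hA.
have h i j : conjc (A j i) = - A i j by have := hE i j; rewrite !mxE.
have im z : conjc z = - z -> z = Complex 0 (complex.Im z) :> R[i].
  case: z => a b [/eqP]; rewrite -subr_eq0 opprK -mulr2n mulrn_eq0 /=.
  by move/eqP->.
have h10 : A 1 0 = Complex (- complex.Re (A 0 1)) (complex.Im (A 0 1)).
  apply: oppr_inj; rewrite -h; case: (A 0 1) => a b.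
  by rewrite /GRing.opp /= opprK.
apply/matrixP => i j; rewrite !mxE /=.
have ord2 (k : 'I_2) : (k == 0) = false -> k = 1.
  by case: k => [[|[|//]] ?] // _; exact: val_inj.
case: eqP => [<-|/eqP ij].
  case: (i =P 0) => [->|/eqP/negbTE/ord2 ->]; rewrite -im //.
have [i0|/negbTE/ord2 i1] := eqVneq i 0; subst i.
  by rewrite (ord2 j) ?(eq_sym j) ?(negbTE ij) //=; case: (A 0 1).
have [->|/negbTE/ord2 j1] := eqVneq j 0; first by rewrite h10.
by rewrite j1 eqxx in ij.
Qed.

HB.instance Definition _ (R : rcfType) :=
  Lmodule_hasFinDim.Build R (u2 R)
    (exist2 _ _ (@u2_coords R) (@u2_coords_linear R) (@u2_coords_bij R)).

Definition u2_bracket (R : rcfType) (A B : u2 R) : u2 R :=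
  U2 (u2_bracket_closed (u2_valP A) (u2_valP B)).

Fact u2_bracket_bilinear (R : rcfType) :
  bilinear_for *:%R *:%R (@u2_bracket R).
Proof.
split=> C a A B; apply: val_inj => /=.
  by rewrite (commutator_bilinear R[i] 2).1.
by rewrite (commutator_bilinear R[i] 2).2.
Qed.

Fact u2_bracketxx (R : rcfType) (A : u2 R) : u2_bracket A A = 0.
Proof. by apply: val_inj; rewrite /= commutatorxx. Qed.

Fact u2_jacobi (R : rcfType) (A B C : u2 R) :
  u2_bracket A (u2_bracket B C) + u2_bracket B (u2_bracket C A)
  + u2_bracket C (u2_bracket A B) = 0.
Proof. by apply: val_inj; rewrite /= commutator_jacobi. Qed.

HB.instance Definition _ (R : rcfType) :=
  isLieAlgebra.Build R (u2 R)
    (@u2_bracket_bilinear R) (@u2_bracketxx R) (@u2_jacobi R).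

(* 'Hom(g, R^o) is the dual space of g. Wedge products are normalised by
   (a /\ b)(x, y) = a(x) b(y) - a(y) b(x), for which the Chevalley-Eilenberg
   differential (d a)(x, y) = - a([x, y]) is an antiderivation. *)

Definition wedge11 (R : fieldType) (g : lieAlgType R) (a b : 'Hom(g, R^o)) :
  g -> g -> R := fun x y => a x * b y - a y * b x.

Definition wedge12 (R : fieldType) (g : lieAlgType R) (a : 'Hom(g, R^o))
    (w : g -> g -> R) : g -> g -> g -> R :=
  fun x y z => a x * w y z + a y * w z x + a z * w x y.

Definition d1 (R : fieldType) (g : lieAlgType R) (a : 'Hom(g, R^o)) :
  g -> g -> R := fun x y => - a (lie x y).

Definition d2 (R : fieldType) (g : lieAlgType R) (w : g -> g -> R) :
  g -> g -> g -> R :=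
  fun x y z => - w (lie x y) z - w (lie y z) x - w (lie z x) y.

Definition nondegenerate (R : fieldType) (g : lieAlgType R)
    (b : g -> g -> R) : Prop :=
  forall x, (forall y, b x y = 0) -> x = 0.

Record lcs (R : fieldType) (g : lieAlgType R) (omega : {biscalar g})
    (lambda : 'Hom(g, R^o)) : Prop := {
  lcs_alternating : forall x, omega x x = 0;
  lcs_nondegenerate : nondegenerate omega;
  lcs_closed : forall x y, d1 lambda x y = 0;
  lcs_d : forall x y z, d2 omega x y z = wedge12 lambda omega x y z
}.

(* The Nijenhuis tensor of J vanishes, i.e. the induced left-invariant almost
   complex structure is integrable. *)
Record complex_structure (R : fieldType) (g : lieAlgType R) (J : 'End(g)) :
    Prop := {
  cs_square : forall x, J (J x) = - x;
  cs_integrable : forall x y,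
    lie (J x) (J y) - J (lie (J x) y) - J (lie x (J y)) - lie x y = 0
}.

Record lcpk (R : fieldType) (g : lieAlgType R) (omega : {biscalar g})
    (J : 'End(g)) (lambda : 'Hom(g, R^o)) : Prop := {
  lcpk_lcs : lcs omega lambda;
  lcpk_complex : complex_structure J;
  lcpk_skew : forall x y, omega (J x) y = - omega x (J y)
}.

Definition proper_lcpk (R : fieldType) (g : lieAlgType R)
    (omega : {biscalar g}) (J : 'End(g)) (lambda : 'Hom(g, R^o)) : Prop :=
  lcpk omega J lambda /\ exists x y z, d2 omega x y z <> 0.

Definition metric (R : fieldType) (g : lieAlgType R) (omega : {biscalar g})
    (J : 'End(g)) : g -> g -> R := fun x y => omega x (J y).

Definition positive_definite (R : realType) (g : lieAlgType R)
    (b : g -> g -> R) : Prop := forall x, x != 0 -> 0 < b x x.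

(* The Levi-Civita connection of the left-invariant metric m, evaluated on
   left-invariant vector fields: nabla x y = nabla_x y. Derivatives of
   m along left-invariant fields vanish. *)
Definition levi_civita (R : fieldType) (g : lieAlgType R) (m : g -> g -> R)
    (nabla : {bilinear g -> g -> g}) : Prop :=
  (forall x y, nabla x y - nabla y x = lie x y) /\
  (forall x y z, m (nabla x y) z + m y (nabla x z) = 0).

Definition lee_field (R : fieldType) (g : lieAlgType R) (m : g -> g -> R)
    (lambda : 'Hom(g, R^o)) (xi : g) : Prop :=
  forall x, m xi x = - (2^-1 * lambda x).

Definition vaisman (R : fieldType) (g : lieAlgType R) (omega : {biscalar g})
    (J : 'End(g)) (lambda : 'Hom(g, R^o)) : Prop :=
  exists (nabla : {bilinear g -> g -> g}) (xi : g),
    [/\ levi_civita (metric omega J) nabla,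
        lee_field (metric omega J) lambda xi &
        forall x, nabla x xi = 0].

Definition biinvariant_scalar_product (R : fieldType) (g : lieAlgType R)
    (B : {biscalar g}) : Prop :=
  [/\ forall x y, B x y = B y x,
      nondegenerate B &
      forall x y z, B (lie x y) z + B y (lie x z) = 0].

Definition dual_basis (R : fieldType) (g : lieAlgType R) n (e : n.-tuple g)
    (i : 'I_n) : 'Hom(g, R^o) := linfun (coord e i : g -> R^o).

Definition u2_normal_form (R : realType) (g : lieAlgType R)
    (omega : {biscalar g}) (J : 'End(g)) (lambda : 'Hom(g, R^o)) : Prop :=
  exists e0 e1 e2 e3 : g,
    let e := [tuple e0; e1; e2; e3] in
    let E := dual_basis e in
    [/\ basis_of fullv e,
        central e0,
        [/\ lie e1 e2 = - e3, lie e2 e3 = - e1 & lie e3 e1 = - e2],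
        lambda = - E 0 &
        exists a b : R,
          let c := - ((1 + a ^+ 2) / b) in
          [/\ b != 0,
              [/\ J e0 = a *: e0 + b *: e1,
                  J e1 = c *: e0 - a *: e1,
                  J e2 = - e3 &
                  J e3 = e2] &
              (exists2 s : R, s != 0 &
                 forall x y, omega x y =
                   s * (wedge11 (E 0) (E 1) x y + wedge11 (E 2) (E 3) x y))
              \/
              ((a = 0 /\ b = 1) /\
               exists phi : 'Hom(g, R^o),
                 [/\ phi != 0,
                     phi \in <<[:: E 1; E 2; E 3]>>%VS &
                     forall x y,
                       omega x y = wedge11 (E 0) phi x y + d1 phi x y])]].

Definition gl2_normal_form (R : realType) (g : lieAlgType R)
    (omega : {biscalar g}) (J : 'End(g)) (lambda : 'Hom(g, R^o)) : Prop :=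
  exists e0 h ep em : g,
    let e := [tuple e0; h; ep; em] in
    let E0 := dual_basis e 0 in
    let Eh := dual_basis e 1 in
    let Ep := dual_basis e 2 in
    let Em := dual_basis e 3 in
    [/\ basis_of fullv e,
        central e0,
        [/\ lie h ep = 2 *: ep, lie h em = - (2 *: em) & lie ep em = h],
        lambda = - E0 &
        exists mu : R[i],
          let mu1 := complex.Re mu in
          let mu2 := complex.Im mu in
          let normmu2 := mu1 ^+ 2 + mu2 ^+ 2 in
          [/\ mu1 != 0,
              [/\ J e0 = (mu2 / mu1) *: e0
                         - (normmu2 / (2 * mu1)) *: (ep - em),
                  J h = ep + em,
                  J ep = mu1^-1 *: e0 - (mu2 / (2 * mu1)) *: (ep - em)
                         - 2^-1 *: h &
                  J em = - (mu1^-1 *: e0) + (mu2 / (2 * mu1)) *: (ep - em)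
                         - 2^-1 *: h] &
              (exists2 s : R, s != 0 &
                 forall x y, omega x y =
                   s * (wedge11 E0 (Ep - Em) x y
                        - 2 * wedge11 Eh (Ep + Em) x y))
              \/
              (mu = 1 /\
               exists ah ap am : R,
                 ah ^+ 2 + 4 * ap * am != 0 /\
                 let phi := ah *: Eh + ap *: Ep + am *: Em in
                 forall x y,
                   omega x y = wedge11 E0 phi x y + d1 phi x y)]].

(* Main.v *)
Require Import Defs.
From HB Require Import structures.
From mathcomp Require Import all_boot all_order all_algebra.
From mathcomp Require Import sesquilinear reals complex ring lra.

Set Implicit Arguments.
Unset Strict Implicit.
Unset Printing Implicit Defensive.

Import Order.TTheory GRing.Theory Num.Theory.
Local Open Scope ring_scope.

(** In part (i), if [x] commutes with [v], then [phi] vanishes on all brackets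
    [lie x y], so that [omega x] is determined by the two numbers [lambda x] and
    [phi x], and [omega] is non-degenerate ([centralizer_dim_le2]).

    For part (ii), complete reducibility provides a central complement of the
    derived algebra. The Lee form is closed and nonzero, so some central [b] has
    [lambda b = 1], and contracting [d omega = lambda /\ omega] with [b] shows that
    [omega] is recovered from the functional [omega b] ([lcs_primitive]). The
    trace form is non-degenerate on the derived algebra ([trace_form_derived]):
    its radical consists of ad-nilpotent elements by Cartan's criterion, and a
    nonzero radical would contain a central element by Engel's theorem. Hence
    [omega b] is represented by a vector [v] of the derived algebra, and the
    argument of part (i) shows that the centralizer of [v] is spanned by [b] and
    [v]. A vector with so small a centralizer exists only in rank one: over the
    complex numbers, a trace computation with the least positive weight of
    [lie v] shows that this weight and its opposite are the only nonzero ones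
    and that they are simple ([rank_one_matrix_dim]). So the dimension is four
    ([lcs_reductive]).

    In dimension four the complex structure yields a basis. Integrability tested
    on [b] says that the component of [J b] in the derived algebra acts by an
    endomorphism commuting with [J], so it rotates a [J]-stable plane
    ([complex_structure_frame]). The remaining structure constant is normalized
    to a sign, which distinguishes u(2) from gl(2). Compatibility of [omega] with
    [J] is a linear system on the primitive [omega e0], whose determinant
    vanishes for a single [J] ([frame_dichotomy]); this gives the normal forms.

    The structures that are not of Vaisman type are found for this exceptional
    [J]. If the Lee field were parallel, its adjoint would be skew for the metric
    ([vaisman_skew]), and one component of this condition fails. *)

(** * Spectral projections of a matrix *)

Lemma mxtrace_idem (F : fieldType) n (Q : 'M[F]_n) : Q *m Q = Q -> \tr Q = (\rank Q)%:R.
Proof.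
move=> QQ; rewrite -{1}[Q]mulmx_base mxtrace_mulC.
suff -> : row_base Q *m col_base Q = 1%:M by rewrite mxtrace1.
apply: (row_free_inj (row_base_free Q)); apply: (row_full_inj (col_base_full Q)).
by rewrite /= mul1mx -(mulmxA (row_base Q)) mulmx_base mulmxA mulmx_base.
Qed.

Lemma mxtrace_nilp (F : closedFieldType) n (N : 'M[F]_n.+1) k : N ^+ k = 0 -> \tr N = 0.
Proof.
move=> Nk; have [r] := closed_field_poly_normal (char_poly N).
rewrite (monicP (char_poly_monic N)) scale1r => rE.
have r0 a : a \in r -> a = 0.
  move=> ar; have : eigenvalue N a.
    rewrite eigenvalue_root_char rE root_prod_XsubC //.
  move=> /eigenvalueP [v vN v0].
  have vNk j : v *m N ^+ j = a ^+ j *: v.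
    elim: j => [|j IHj]; first by rewrite expr0 scale1r mulmx1.
    by rewrite exprSr -mulmxE mulmxA IHj -scalemxAl vN scalerA exprSr.
  have /esym/eqP := vNk k; rewrite Nk mulmx0 scaler_eq0 (negbTE v0) orbF.
  by rewrite expf_eq0 => /andP [_ /eqP].
have cE : char_poly N = 'X^(n.+1).
  have sz : size r = n.+1.
    by apply: succn_inj; rewrite -(size_char_poly N) rE size_prod_XsubC.
  rewrite rE (eq_big_seq (fun=> 'X)) => [|a /r0 ->]; last by rewrite subr0.
  by rewrite big_const_seq count_predT sz iter_mulr_1.
apply: oppr_inj; rewrite oppr0 -char_poly_trace // cE coefXn /=.
by rewrite ltn_eqF.
Qed.

Section Annihilators.
Variables (F : fieldType) (n : nat).
Implicit Types A : 'M[F]_n.+1.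

Lemma coprime_XsubC_exp (a b : F) k l :
  a != b -> coprimep (('X - a%:P) ^+ k) (('X - b%:P) ^+ l).
Proof.
move=> ab; apply/coprimep_expl/coprimep_expr.
by rewrite coprimep_XsubC root_XsubC eq_sym.
Qed.

Lemma horner_mx_XsubC_exp A (a : F) k :
  horner_mx A (('X - a%:P) ^+ k) = (A - a%:M) ^+ k.
Proof. by rewrite rmorphXn rmorphB /= horner_mx_X horner_mx_C. Qed.

Lemma coprime_annihilators A (p q : {poly F}) k (X : 'M[F]_(k, n.+1)) :
  coprimep p q -> X *m horner_mx A p = 0 -> X *m horner_mx A q = 0 -> X = 0.
Proof.
move=> /Bezout_eq1_coprimepP [[u w] /= uw1] Xp Xq.
rewrite -[X]mulmx1 -[1%:M](rmorph1 (horner_mx A)) -uw1 ![_ * p]mulrC ![_ * q]mulrC.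
by rewrite rmorphD !rmorphM /= mulmxDr -!mulmxE !mulmxA Xp Xq !mul0mx addr0.
Qed.

Lemma disjoint_annihilators A a b i j k (X : 'M[F]_(k, n.+1)) :
  a != b -> X *m (A - a%:M) ^+ i = 0 -> X *m (A - b%:M) ^+ j = 0 -> X = 0.
Proof.
move=> ab; rewrite -!horner_mx_XsubC_exp.
exact/coprime_annihilators/coprime_XsubC_exp.
Qed.

(** Bezout's identity, one factor at a time. Modulo the product, the
    polynomials [e a] become the spectral idempotents of a matrix that the
    product annihilates. *)
Lemma partial_fractions (s : seq F) m : uniq s ->
  let p := \prod_(a <- s) ('X - a%:P) ^+ m in
  exists e : F -> {poly F},
    (forall a, a \in s -> p %| e a * ('X - a%:P) ^+ m) /\
    p %| \sum_(a <- s) e a - 1.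
Proof.
elim: s => [|a s IHs] /=; first by exists (fun=> 0); rewrite !big_nil dvd1p.
move=> /andP [as_ us]; have [e [eP e1]] := IHs us.
set p := (\prod_(_ <- s) _) in eP e1; rewrite big_cons -/p.
have /Bezout_eq1_coprimepP [[u w] /= uw1] : coprimep (('X - a%:P) ^+ m) p.
  rewrite /p; elim: (s) as_ => [|b t IHt]; first by rewrite big_nil coprimep1.
  rewrite inE negb_or big_cons coprimepMr => /andP [ab /IHt ->].
  by rewrite coprime_XsubC_exp.
exists (fun b => if b == a then w * p else u * ('X - a%:P) ^+ m * e b).
split=> [b|].
  rewrite inE; case: eqVneq => [-> _|_ /= bs].
    by rewrite -mulrA [p * _]mulrC; apply: dvdp_mulIr.
  by rewrite -(mulrA _ (e b)); apply: dvdp_mul; [apply: dvdp_mulIr|apply: eP].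
rewrite big_cons eqxx (@eq_big_seq _ _ _ _ _ _
  (fun b => u * ('X - a%:P) ^+ m * e b)); last first.
  by move=> b bs; case: eqVneq => // ba; rewrite -ba bs in as_.
rewrite -mulr_sumr -uw1 -[X in _ %| X]/(w * p + _ * (\sum_(b <- s) e b) - _).
have -> : w * p + u * ('X - a%:P) ^+ m * (\sum_(b <- s) e b)
   - (u * ('X - a%:P) ^+ m + w * p)
   = u * ('X - a%:P) ^+ m * (\sum_(b <- s) e b - 1) by ring.
by apply: dvdp_mul => //; apply: dvdp_mulIr.
Qed.

End Annihilators.

Section SpectralProjections.
Variable C : closedFieldType.
Variable n : nat.
Implicit Types A : 'M[C]_n.+1.

(** The projections of [A] onto its generalized eigenspaces, indexed by all
    scalars so that non-eigenvalues simply get the zero projection. *)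
Record spectral_family A (s : seq C) (P : C -> 'M[C]_n.+1) m : Prop := {
  spectral_uniq : uniq s;
  spectral_sum : \sum_(a <- s) P a = 1%:M;
  spectral_comm : forall a, P a *m A = A *m P a;
  spectral_nilp : forall a, P a *m (A - a%:M) ^+ m = 0;
  spectral_out : forall a, a \notin s -> P a = 0
}.

(** Partial fractions of a multiple of the characteristic polynomial: by the
    Cayley-Hamilton theorem, their congruences become identities at [A]. *)
Lemma spectral_family_exists A : exists s P m, spectral_family A s P m.
Proof.
have [r] := closed_field_poly_normal (char_poly A).
rewrite (monicP (char_poly_monic A)) scale1r => rE.
pose s := undup r; pose m := size r.
have [e [eP e1]] := partial_fractions m (undup_uniq r).
set p := (\prod_(_ <- s) _) in eP e1.
have pA : horner_mx A p = 0.
  suff /dvdpP [q ->] : char_poly A %| p.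
    by rewrite rmorphM /= Cayley_Hamilton mulr0.
  rewrite rE [X in X %| _](_ : _ =
    \prod_(a <- s) ('X - a%:P) ^+ count_mem a r).
    rewrite /p; elim: s {eP e1 p} => [|a t IHt]; rewrite ?big_nil ?dvd1p //.
    by rewrite !big_cons dvdp_mul // dvdp_exp2l // count_size.
  by rewrite -(big_undup_iterop_count _ r predT) /=.
have dvdA q : p %| q -> horner_mx A q = 0.
  by move=> /dvdpP [q' ->]; rewrite rmorphM /= pA mulr0.
exists s, (fun a => if a \in s then horner_mx A (e a) else 0), m.
split=> [||a|a|a].
- exact: undup_uniq.
- have /dvdA := e1; rewrite rmorphB rmorph1 rmorph_sum /= => /subr0_eq h.
  by apply: etrans h; apply: eq_big_seq => a ->.
- by case: ifP => _; rewrite ?mul0mx ?mulmx0 // !mulmxE; apply: comm_horner_mx.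
- case: ifP => [/eP/dvdA|_]; last by rewrite mul0mx.
  by rewrite rmorphM /= horner_mx_XsubC_exp.
- by move/negbTE->.
Qed.

Section Family.
Variables (A : 'M[C]_n.+1) (s : seq C) (P : C -> 'M[C]_n.+1) (m : nat).
Hypothesis AP : spectral_family A s P m.

Lemma spectral_decomp k (X : 'M[C]_(k, n.+1)) : X = \sum_(a <- s) X *m P a.
Proof. by rewrite -mulmx_sumr (spectral_sum AP) mulmx1. Qed.

Lemma spectral_nilp_commr k l a (X : 'M[C]_(k, n.+1)) :
  X *m (A - a%:M) ^+ l = 0 -> forall b, X *m P b *m (A - a%:M) ^+ l = 0.
Proof.
move=> X0 b; have cPA : P b * (A - a%:M) = (A - a%:M) * P b.
  by rewrite mulrBr mulrBl -!mulmxE (spectral_comm AP) scalar_mxC.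
rewrite -mulmxA mulmxE (commrX l cPA) -mulmxE mulmxA X0 mul0mx //.
Qed.

Lemma spectral_kill k l a b (X : 'M[C]_(k, n.+1)) :
  X *m (A - a%:M) ^+ l = 0 -> b != a -> X *m P b = 0.
Proof.
move=> X0 ba; apply: (disjoint_annihilators (A := A) ba (i := m) (j := l)).
  by rewrite -mulmxA (spectral_nilp AP) mulmx0.
exact: spectral_nilp_commr.
Qed.

(** The projections of [X] to the other eigenvalues are annihilated by two
    coprime polynomials in [A], so [P a] is the only one that counts. *)
Lemma spectral_fix k l a (X : 'M[C]_(k, n.+1)) :
  X *m (A - a%:M) ^+ l = 0 -> X *m P a = X.
Proof.
move=> X0; rewrite [RHS]spectral_decomp.
have [as_|as_] := boolP (a \in s); last first.
  rewrite (spectral_out AP as_) mulmx0 big_seq big1 // => b bs.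
  by apply: (spectral_kill X0); apply: contraNneq as_ => <-.
rewrite (bigD1_seq a) ?(spectral_uniq AP) //= big1 ?addr0 // => b ba.
exact: (spectral_kill X0).
Qed.

Lemma spectral_idem a : P a *m P a = P a.
Proof. exact/spectral_fix/(spectral_nilp AP). Qed.

(** [A - a] is nilpotent on the image of [P a] and contributes no trace. *)
Lemma mxtrace_spectral a : \tr (P a *m A) = a * (\rank (P a))%:R.
Proof.
have cPA : GRing.comm (P a) (A - a%:M).
  by rewrite /GRing.comm mulrBr mulrBl -!mulmxE (spectral_comm AP) scalar_mxC.
have N0 : \tr (P a *m (A - a%:M)) = 0.
  apply: (mxtrace_nilp (k := m.+1)).
  rewrite mulmxE exprMn_comm // exprS -mulrA exprSr !mulrA.
  rewrite -(mulrA (P a) (P a ^+ m)) -!mulmxE.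
  have cc := commrX m cPA; have cc2 : GRing.comm (P a ^+ m) ((A - a%:M) ^+ m).
    by apply/commr_sym/commrX/commr_sym.
  by rewrite [P a ^+ m *m _]cc2 mulmxA (spectral_nilp AP) !mul0mx.
have := N0; rewrite mulmxBr raddfB /= mul_mx_scalar mxtraceZ.
by rewrite (mxtrace_idem (spectral_idem a)) => /subr0_eq.
Qed.

End Family.
End SpectralProjections.

(** * Weights of inner derivations and the trace form *)

(** A Lie bracket on row vectors: [w *m ad u] is the bracket of [u] and [w].
    Rows are acted on from the right, so that [adJ], the Jacobi identity,
    makes [ad] an anti-homomorphism. *)
Section MatrixLie.
Variables (C : numClosedFieldType) (n : nat).
Variable ad : {linear 'rV[C]_n.+1 -> 'M[C]_n.+1}.
Hypothesis adJ : forall u w, ad (w *m ad u) = ad w *m ad u - ad u *m ad w.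

Let adD u w : ad (u + w) = ad u + ad w. Proof. exact: raddfD. Qed.

Section Weights.
Variable x : 'rV[C]_n.+1.
Let A := ad x.

Lemma bracket_derivation k (X : 'M[C]_(k, n.+1)) u a b :
  X *m ad u *m (A - (a + b)%:M) =
  X *m ad (u *m (A - a%:M)) + X *m (A - b%:M) *m ad u.
Proof.
have -> : ad (u *m (A - a%:M)) = ad u *m A - A *m ad u - a *: ad u.
  by rewrite mulmxBr mul_mx_scalar linearB linearZ /= adJ.
rewrite !mulmxBr mulmxBl !mulmxA !mul_mx_scalar -scalemxAl -scalemxAr scalerDl.
by rewrite [X in _ = X + _]addrAC [in RHS]addrA subrK opprD addrA.
Qed.

(** Generalized eigenspaces of an inner derivation multiply by adding their
    eigenvalues. *)
Lemma bracket_weight k (X : 'M[C]_(k, n.+1)) u a b p q :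
  u *m (A - a%:M) ^+ p = 0 -> X *m (A - b%:M) ^+ q = 0 ->
  X *m ad u *m (A - (a + b)%:M) ^+ (p + q) = 0.
Proof.
move Dl: (p + q)%N => l.
elim: l p q Dl u X => [|l IHl] p q Dl u X.
  have [-> _] : p = 0%N /\ q = 0%N by case: p q Dl => [|?] [|?].
  by rewrite mulmx1 => -> _; rewrite linear0 mulmx0 mul0mx.
case: p Dl => [|p] Dl; first by rewrite mulmx1 => ->; rewrite linear0 mulmx0 mul0mx.
case: q Dl => [|q] Dl; first by move=> _; rewrite mulmx1 => ->; rewrite !mul0mx.
move=> up Xq; rewrite exprS -mulmxE mulmxA bracket_derivation mulmxDl.
rewrite (IHl p q.+1) ?(IHl p.+1 q) ?addr0 //.
- by move: Dl; rewrite addnS => -[].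
- by rewrite -mulmxA mulmxE -exprS.
- by move: Dl; rewrite addSn => -[].
- by rewrite -mulmxA mulmxE -exprS.
Qed.

End Weights.

Section ConjugateDerivation.
Variables (x : 'rV[C]_n.+1) (s : seq C) (P : C -> 'M[C]_n.+1) (m : nat).
Hypothesis xP : spectral_family (ad x) s P m.

Let D : 'M[C]_n.+1 := \sum_(a <- s) a^* *: P a.

Let mulD k (X : 'M[C]_(k, n.+1)) l a :
  X *m (ad x - a%:M) ^+ l = 0 -> X *m D = a^* *: X.
Proof.
move=> X0; rewrite -{2}(spectral_fix xP X0) mulmx_sumr.
have [as_|as_] := boolP (a \in s).
  rewrite (bigD1_seq a) ?(spectral_uniq xP) //= -scalemxAr.
  rewrite big1 ?addr0 // => b ba.
  by rewrite -scalemxAr (spectral_kill xP X0) // scaler0.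
rewrite (spectral_out xP as_) mulmx0 scaler0 big_seq big1 // => b bs.
rewrite -scalemxAr (spectral_kill xP X0) ?scaler0 //.
by apply: contraNneq as_ => <-.
Qed.

(** Weights add under the bracket and conjugation is additive, so scaling each
    weight space by its conjugate weight is a derivation. *)
Let derD u : ad (u *m D) = ad u *m D - D *m ad u.
Proof.
apply/subr0_eq; pose M w := ad (w *m D) - (ad w *m D - D *m ad w).
rewrite -/(M u).
have M0 a : M (u *m P a) = 0.
  have ua : u *m P a *m (ad x - a%:M) ^+ m = 0.
    by rewrite -mulmxA (spectral_nilp xP) mulmx0.
  rewrite -[M _]mul1mx -(spectral_sum xP) mulmx_suml big1 // => b _.
  rewrite /M (mulD ua) linearZ /= !mulmxBr !mulmxA -scalemxAr.
  rewrite (mulD (bracket_weight ua (spectral_nilp xP b))).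
  rewrite (mulD (spectral_nilp xP b)) -scalemxAl.
  by rewrite rmorphD scalerDl addrK subrr.
have MD : {morph M : w1 w2 / w1 + w2}.
  move=> w1 w2; rewrite /M mulmxDl !adD mulmxDl mulmxDr.
  by rewrite !opprB opprD (addrACA (D *m ad w1)) (addrACA (ad (w1 *m D))).
have -> := congr1 M (spectral_decomp xP u).
rewrite (big_morph M MD (id1 := 0)) ?big1 //.
by rewrite /M mul0mx raddf0 mul0mx mulmx0 !subrr.
Qed.

(** The commutator of [ad w] and [D] is [ad (w *m D)], so up to sign this trace
    is the trace form of [u] and [w *m D]. *)
Let tr_bracket u w :
  (forall y, \tr (ad u *m ad y) = 0) -> \tr (ad (w *m ad u) *m D) = 0.
Proof.
move=> u0; rewrite adJ mulmxBl raddfB /= -(mulmxA (ad u)).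
have -> : ad w *m D = ad (w *m D) + D *m ad w by rewrite derD subrK.
rewrite mulmxDr raddfD /= u0 add0r (mulmxA (ad u)) [\tr (_ *m ad w)]mxtrace_mulC.
by rewrite mulmxA subrr.
Qed.

(** The trace is the sum of [`|a| ^+ 2] times the multiplicity of [a] over the
    weights [a], so zero is the only weight. *)
Let trD : \tr (ad x *m D) = 0 -> exists k, ad x ^+ k = 0.
Proof.
rewrite mulmx_sumr raddf_sum /=.
under eq_bigr => a _.
  rewrite -scalemxAr mxtraceZ -(spectral_comm xP) (mxtrace_spectral xP) mulrA.
  rewrite [_^* * _]mulrC.
  over.
move=> sum0; exists m.
have P0 a : a != 0 -> P a = 0.
  move=> a0; have [as_|/(spectral_out xP)//] := boolP (a \in s).
  have : a * a^* * (\rank (P a))%:R = 0.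
    have ge0 c : 0 <= c * c^* * (\rank (P c))%:R :> C.
      by rewrite mulr_ge0 ?mul_conjC_ge0 ?ler0n.
    move/eqP: sum0; rewrite (bigD1_seq a) ?(spectral_uniq xP) //=.
    rewrite paddr_eq0 ?sumr_ge0 //.
    by case/andP => /eqP.
  move/eqP; rewrite mulf_eq0 mul_conjC_eq0 (negbTE a0) /=.
  by rewrite pnatr_eq0 mxrank_eq0 => /eqP.
have P1 : P 0 = 1%:M.
  rewrite -(spectral_sum xP); have [s0|s0] := boolP (0 \in s).
    rewrite (bigD1_seq 0) ?(spectral_uniq xP) //= big1 ?addr0 //.
  rewrite (spectral_out xP s0) big_seq big1 // => a as_; apply: P0.
  by apply: contraNneq s0 => <-.
have := spectral_nilp xP 0; rewrite P1 mul1mx.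
by rewrite (_ : (0 : C)%:M = 0) ?subr0 // raddf0.
Qed.

Lemma conjugate_derivation_aux : exists E : 'M[C]_n.+1,
  (forall u w, (forall y, \tr (ad u *m ad y) = 0) ->
     \tr (ad (w *m ad u) *m E) = 0) /\
  (\tr (ad x *m E) = 0 -> exists k, ad x ^+ k = 0).
Proof. by exists D; split; [apply: tr_bracket|apply: trD]. Qed.

End ConjugateDerivation.

(** The heart of Cartan's criterion: [E] scales every weight space of [ad x] by
    the conjugate weight. Brackets with the radical of the trace form have zero
    trace against [E], which for [ad x] itself forces nilpotency. *)
Lemma conjugate_derivation x : exists E : 'M[C]_n.+1,
  (forall u w, (forall y, \tr (ad u *m ad y) = 0) ->
     \tr (ad (w *m ad u) *m E) = 0) /\
  (\tr (ad x *m E) = 0 -> exists k, ad x ^+ k = 0).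
Proof.
have [s [P [m xP]]] := spectral_family_exists (ad x).
exact: conjugate_derivation_aux xP.
Qed.

End MatrixLie.

(** * Lie algebras with a self-centralizing vector *)

Section LexicographicSign.
Variable C : numClosedFieldType.
Implicit Types z : C.

(** The positive cone of a translation-invariant total order on [C], which
    compares real parts first and then imaginary parts. It singles out a least
    positive weight. *)
Definition lexpos z := (0 < 'Re z) || ('Re z == 0) && (0 < 'Im z).

Lemma lexposP z : [|| z == 0, lexpos z | lexpos (- z)].
Proof.
rewrite /lexpos !raddfN /= !oppr_gt0 oppr_eq0.
case: (real_ltgt0P (Creal_Re z)) => [re|re|re]; rewrite ?orbT //=.
case: (real_ltgt0P (Creal_Im z)) => [im|im|im]; rewrite ?orbT //=.
by rewrite [z]Crect re im mulr0 addr0 eqxx.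
Qed.

Lemma lexposD z1 z2 : lexpos z1 -> lexpos z2 -> lexpos (z1 + z2).
Proof.
rewrite /lexpos !raddfD /=.
move=> /orP [p1|/andP [/eqP -> p1]] /orP [p2|/andP [/eqP -> p2]].
- by rewrite addr_gt0.
- by rewrite addr0 p1.
- by rewrite add0r p2.
- by rewrite addr0 eqxx addr_gt0 ?orbT.
Qed.

Lemma lexpos0 : lexpos 0 = false.
Proof. by rewrite /lexpos !raddf0 !ltxx andbF. Qed.

Lemma lexpos_neq0 z : lexpos z -> z != 0.
Proof. by apply: contraTneq => ->; rewrite lexpos0. Qed.

Lemma lexposN z : lexpos z -> lexpos (- z) = false.
Proof.
by move=> pz; apply/negP => /(lexposD pz); rewrite subrr lexpos0.
Qed.

Lemma lexpos_natmul z k : lexpos z -> (0 < k)%N -> lexpos (z * k%:R).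
Proof.
move=> pz; case: k => // k _; elim: k => [|k IHk]; first by rewrite mulr1.
by rewrite -natr1 mulrDr mulr1 lexposD.
Qed.

Lemma lexpos_sum_eq0 (I : eqType) (r : seq I) (F : I -> C) :
  (forall i, i \in r -> F i = 0 \/ lexpos (F i)) ->
  \sum_(i <- r) F i = 0 -> forall i, i \in r -> F i = 0.
Proof.
have nn (r' : seq I) : (forall i, i \in r' -> F i = 0 \/ lexpos (F i)) ->
    \sum_(i <- r') F i = 0 \/ lexpos (\sum_(i <- r') F i).
  move=> Fr; rewrite big_seq.
  apply: (big_ind (fun z => z = 0 \/ lexpos z)) => //; first by left.
  move=> z1 z2 [->|p1] [->|p2]; rewrite ?addr0 ?add0r; auto.
  by right; apply: lexposD.
elim: r => // i r IHr Fr; rewrite big_cons => sum0.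
have Fr' j : j \in r -> F j = 0 \/ lexpos (F j).
  by move=> jr; apply: Fr; rewrite inE jr orbT.
have Fi0 : F i = 0.
  have [//|pF] := Fr i (mem_head _ _).
  have [e|p] := nn r Fr'; first by rewrite e addr0 in sum0.
  by have := lexposD pF p; rewrite sum0 lexpos0.
move=> j; rewrite inE => /orP [/eqP -> //|]; apply: IHr => //.
by move: sum0; rewrite Fi0 add0r.
Qed.

Lemma lexpos_min (r : seq C) : r != [::] ->
  exists2 a, a \in r & forall b, b \in r -> ~~ lexpos (a - b).
Proof.
elim: r => // c [|d r] IHr _.
  exists c; rewrite ?mem_head // => b; rewrite inE => /eqP ->.
  by rewrite subrr lexpos0.
have [//|a ar amin] := IHr; have [ac|ac] := boolP (lexpos (a - c)).
  exists c; rewrite ?mem_head // => b; rewrite inE => /orP [/eqP ->|br].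
    by rewrite subrr lexpos0.
  apply: contra (amin b br) => cb.
  by rewrite -(subrK c a) -addrA lexposD.
exists a => [|b]; rewrite inE ?ar ?orbT // => /orP [/eqP -> //|].
exact: amin.
Qed.

End LexicographicSign.

Lemma trmx11 (R : nzRingType) (X : 'M[R]_1) : X^T = X.
Proof. by rewrite [X]mx11_scalar tr_scalar_mx. Qed.

Lemma last_nonzero_iterate (F : fieldType) n (u : 'rV[F]_n) (M : 'M[F]_n) m :
  u != 0 -> u *m M ^+ m = 0 -> exists2 f : 'rV[F]_n, f != 0 & f *m M = 0.
Proof.
elim: m u => [|m IHm] u u0; first by rewrite mulmx1 => e; rewrite e eqxx in u0.
have [uM|uM] := eqVneq (u *m M) 0; first by exists u.
by rewrite exprS -mulmxE mulmxA; apply: IHm.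
Qed.

Section RankOne.
Variables (C : numClosedFieldType) (n : nat).
Variable ad : {linear 'rV[C]_n.+1 -> 'M[C]_n.+1}.
Hypothesis adC : forall u w, u *m ad w = - (w *m ad u).
Hypothesis adJ : forall u w, ad (w *m ad u) = ad w *m ad u - ad u *m ad w.
Variable G : 'M[C]_n.+1.
Hypothesis Gsym : G^T = G.
Hypothesis Gfree : row_free G.
Hypothesis Ginv : forall u, ad u *m G = - (G *m (ad u)^T).
Variables b v : 'rV[C]_n.+1.
Let A := ad v.
Hypothesis ad_b : ad b = 0.
Hypothesis kerA : forall u, u *m A = 0 -> exists k l, u = k *: b + l *: v.
Hypothesis bGb : b *m G *m b^T != 0.
Hypothesis vGv : v *m G *m v^T != 0.
Hypothesis bGv : b *m G *m v^T = 0.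
Hypothesis A0 : A != 0.

Let vGb : v *m G *m b^T = 0.
Proof. by rewrite -[LHS]trmx11 !trmx_mul trmxK Gsym mulmxA bGv. Qed.

Let in_bv (u : 'rV[C]_n.+1) k l : u = k *: b + l *: v ->
  (u *m G *m b^T = 0 -> k = 0) /\ (u *m G *m v^T = 0 -> l = 0).
Proof.
move=> ->; rewrite !mulmxDl -!scalemxAl bGv vGb !scaler0 addr0 add0r.
split=> /eqP; rewrite scaler_eq0 ?(negbTE bGb) ?(negbTE vGv) orbF.
  by move/eqP.
by move/eqP.
Qed.

Let vA : v *m A = 0.
Proof.
have /eqP : (2 : C) *: (v *m A) = 0.
  by rewrite scaler_nat mulr2n; apply/eqP; rewrite addr_eq0; apply/eqP/adC.
by rewrite scaler_eq0 pnatr_eq0 => /eqP.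
Qed.

Let bad u : b *m ad u = 0.
Proof. by rewrite adC ad_b mulmx0 oppr0. Qed.

Let invG (X Y : 'rV[C]_n.+1) u :
  X *m ad u *m G *m Y^T = - (X *m G *m (Y *m ad u)^T).
Proof. by rewrite trmx_mul -(mulmxA X) Ginv mulmxN mulNmx !mulmxA. Qed.

Let kerA2 (u : 'rV[C]_n.+1) : u *m A *m A = 0 -> u *m A = 0.
Proof.
move=> uAA; have [k [l uA]] := kerA uAA; have [k0 l0] := in_bv uA.
rewrite uA k0 ?l0 ?scale0r ?addr0 //.
  by rewrite invG vA trmx0 mulmx0 oppr0.
by rewrite invG bad trmx0 mulmx0 oppr0.
Qed.

Let kerAk (u : 'rV[C]_n.+1) k : u *m A ^+ k = 0 -> u *m A = 0.
Proof.
elim: k => [|k IHk]; first by rewrite mulmx1 => ->; rewrite mul0mx.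
case: k IHk => [|k] IHk; first by rewrite expr1.
rewrite !exprSr -!mulmxE !mulmxA => /kerA2 h; apply: IHk.
by rewrite exprSr -mulmxE mulmxA.
Qed.

Variables (s : seq C) (P : C -> 'M[C]_n.+1) (m : nat).
Hypothesis AP : spectral_family A s P m.

Let weight0 k (X : 'M[C]_(k, n.+1)) l : X *m (A - 0%:M) ^+ l = 0 -> X *m A = 0.
Proof.
rewrite raddf0 subr0 => X0; apply/row_matrixP => i; rewrite row_mul row0.
by apply: (@kerAk _ l); rewrite -row_mul X0 row0.
Qed.

Let P0A : P 0 *m A = 0.
Proof. exact: weight0 (spectral_nilp AP 0). Qed.

Let P0E : exists x y : 'cV[C]_n.+1, P 0 = x *m b + y *m v /\ v *m y = 1%:M
  /\ \tr (P 0) = 2.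
Proof.
have /sub_addsmxP [[x y] /= xy] : (P 0 <= b + v)%MS.
  apply/row_subP => i; have [|k [l ->]] := @kerA (row i (P 0)).
    by rewrite -row_mul P0A row0.
  by rewrite addmx_sub_adds ?scalemx_sub.
exists x, y.
have fixP (u : 'rV[C]_n.+1) : u *m A = 0 -> u *m P 0 = u.
  by move=> uA; apply: (spectral_fix AP (l := 1)); rewrite expr1 raddf0 subr0.
have coef (u : 'rV[C]_n.+1) : u *m A = 0 -> u = (u *m x) 0 0 *: b + (u *m y) 0 0 *: v.
  move=> /fixP; rewrite xy mulmxDr !mulmxA.
  by rewrite [u *m x]mx11_scalar [u *m y]mx11_scalar !mul_scalar_mx !mxE !mulr1n.
have bx : b *m x = 1%:M.
  rewrite [b *m x]mx11_scalar; congr (_%:M).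
  have := coef b (bad v); set k := (_ 0 0); set l := (_ 0 0) => e.
  have [h _] : ((b - b) *m G *m b^T = 0 -> k - 1 = 0) /\
               ((b - b) *m G *m v^T = 0 -> l = 0).
    by apply: in_bv; rewrite {1}e scalerBl scale1r addrAC.
  by apply/subr0_eq/h; rewrite subrr !mul0mx.
have vy : v *m y = 1%:M.
  rewrite [v *m y]mx11_scalar; congr (_%:M).
  have := coef v vA; set k := (_ 0 0); set l := (_ 0 0) => e.
  have [_ h] : ((v - v) *m G *m b^T = 0 -> k = 0) /\
               ((v - v) *m G *m v^T = 0 -> l - 1 = 0).
    by apply: in_bv; rewrite {1}e scalerBl scale1r addrA.
  by apply/subr0_eq/h; rewrite subrr !mul0mx.
rewrite xy mxtraceD (mxtrace_mulC x) (mxtrace_mulC y) bx vy.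
by rewrite mxtrace_scalar mulr1n -mulr2n.
Qed.

(** Invariance of the form makes [A] skew, so that pairing with [X] and [Y]
    multiplies by [a + c] up to terms of lower nilpotency order. *)
Let orthG k l (X : 'M[C]_(k, n.+1)) (Y : 'M[C]_(l, n.+1)) a c p q :
  a + c != 0 -> X *m (A - a%:M) ^+ p = 0 -> Y *m (A - c%:M) ^+ q = 0 ->
  X *m G *m Y^T = 0.
Proof.
move=> ac; move Dr: (p + q)%N => r.
elim: r p q Dr X Y => [|r IHr] p q Dr X Y.
  have [-> _] : p = 0%N /\ q = 0%N by case: p q Dr => [|?] [|?].
  by rewrite mulmx1 => -> _; rewrite !mul0mx.
case: p Dr => [|p] Dr; first by rewrite mulmx1 => -> _; rewrite !mul0mx.
case: q Dr => [|q] Dr; first by move=> _; rewrite mulmx1 => ->; rewrite trmx0 mulmx0.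
move=> Xp Yq; apply: (scalerI ac); rewrite scaler0.
have h1 : X *m (A - a%:M) *m G *m Y^T = 0.
  apply: (IHr p q.+1) => //; first by move: Dr; rewrite addSn => -[].
  by rewrite -mulmxA mulmxE -exprS.
have h2 : X *m G *m (Y *m (A - c%:M))^T = 0.
  apply: (IHr p.+1 q) => //; first by move: Dr; rewrite addnS => -[].
  by rewrite -mulmxA mulmxE -exprS.
move: h1 h2; rewrite !mulmxBr !mul_mx_scalar !mulmxBl linearB linearZ /=.
rewrite mulmxBr trmx_mul -(mulmxA X A) Ginv mulmxN mulNmx -!scalemxAl -scalemxAr.
rewrite !mulmxA => /subr0_eq h1 /subr0_eq h2.
by rewrite scalerDl -h1 -h2 addNr.
Qed.

(** Orthogonality leaves only the opposite weight on the other side; hence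
    opposite weights have the same multiplicity. *)
Let PG a : P a *m G = G *m (P (- a))^T.
Proof.
have h c d : c + d != 0 -> P c *m G *m (P d)^T = 0.
  by move=> cd; apply: orthG cd (spectral_nilp AP c) (spectral_nilp AP d).
have sumT : \sum_(c <- s) (P c)^T = 1%:M.
  by rewrite -raddf_sum /= (spectral_sum AP) trmx1.
have sumR c (M : 'M[C]_n.+1) (F : C -> 'M[C]_n.+1) :
    (forall d, d != c -> F d = 0) -> (c \notin s -> F c = 0) ->
    \sum_(d <- s) F d = F c.
  move=> F0 Fc; have [cs|cs] := boolP (c \in s).
    by rewrite (bigD1_seq c) ?(spectral_uniq AP) //= big1 ?addr0.
  rewrite Fc // big_seq big1 // => d ds; apply: F0.
  by apply: contraNneq cs => <-.
transitivity (P a *m G *m (P (- a))^T).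
  rewrite -[LHS]mulmx1 -sumT mulmx_sumr; apply: sumR => // [d da|].
    by apply: h; apply: contraNneq da => /eqP; rewrite addrC addr_eq0.
  by move/(spectral_out AP) ->; rewrite trmx0 mulmx0.
rewrite -[RHS]mul1mx -(spectral_sum AP) mulmx_suml; apply/esym.
under eq_bigr do rewrite mulmxA.
apply: (sumR a) => // [d da|].
  by apply: h; apply: contraNneq da => /eqP; rewrite addr_eq0 opprK.
by move/(spectral_out AP) ->; rewrite !mul0mx.
Qed.

Let rankN a : \rank (P (- a)) = \rank (P a).
Proof.
rewrite -(mxrankMfree (P a) Gfree) PG -[RHS]mxrank_tr trmx_mul trmxK Gsym.
by rewrite mxrankMfree.
Qed.

Let PN0 a : (P (- a) == 0) = (P a == 0).
Proof. by rewrite -!mxrank_eq0 rankN. Qed.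

(** If zero were the only weight, [A] would vanish. *)
Let least_weight : exists a, [/\ lexpos a, P a != 0 &
  forall c, lexpos c -> lexpos (a - c) -> P c = 0].
Proof.
pose t := [seq a <- s | lexpos a && (P a != 0)].
have tP a : lexpos a -> P a != 0 -> a \in t.
  move=> pa Pa; rewrite mem_filter pa Pa /=.
  by apply: contraNT Pa => /(spectral_out AP) ->.
have [t0|/lexpos_min [a ta amin]] := eqVneq t [::]; last first.
  exists a; move: ta; rewrite mem_filter => /andP [/andP [pa Pa] _]; split=> //.
  move=> c pc pac; apply/eqP; apply: contraTT pac => Pc.
  exact/amin/tP.
have Pz a : a != 0 -> P a = 0.
  move=> a0; apply/eqP; have := lexposP a; rewrite (negbTE a0) /=.
  case/orP => pa; apply: contraT => Pa; first by have := tP a pa Pa; rewrite t0.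
  by have := tP (- a) pa; rewrite PN0 t0 => /(_ Pa).
case/eqP: A0; rewrite -[A]mul1mx -(spectral_sum AP) mulmx_suml big1 // => a _.
by have [->|/Pz ->] := eqVneq a 0; rewrite ?P0A ?mul0mx.
Qed.

(** [f] is an eigenvector of weight [- al], and [e] an element of the opposite
    weight space that pairs nontrivially with it. Their bracket has weight zero,
    so it is a combination of [b] and [v]; pairing with [b] and [v] computes the
    coefficients, by invariance of the form. *)
Let ladder al : lexpos al -> P al != 0 -> exists e f : 'rV[C]_n.+1,
  exists2 ga, ga != 0 &
  [/\ f *m A = - al *: f, e *m (A - al%:M) ^+ m = 0 & f *m ad e = ga *: v].
Proof.
move=> pal Pal.
have /rowV0Pn [u uP u0] : P (- al) != 0 by rewrite PN0.
have [f f0 fA] : exists2 f : 'rV[C]_n.+1, f != 0 & f *m (A - (- al)%:M) = 0.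
  apply: (@last_nonzero_iterate _ _ u _ m) => //.
  by have /submxP [D ->] := uP; rewrite -mulmxA (spectral_nilp AP) mulmx0.
have fA1 : f *m (A - (- al)%:M) ^+ 1 = 0 by rewrite expr1.
have {}fA : f *m A = - al *: f.
  by move: fA; rewrite mulmxBr mul_mx_scalar => /subr0_eq.
have PGf : P al *m G *m f^T = G *m f^T.
  by rewrite PG -mulmxA -trmx_mul (spectral_fix AP fA1).
have Gf0 : G *m f^T != 0.
  apply: contra f0 => /eqP /(congr1 trmx); rewrite trmx_mul trmxK Gsym trmx0.
  by move=> fG; apply/eqP/(row_free_inj Gfree); rewrite /= fG mul0mx.
have [i eGf] : exists i, row i (P al) *m G *m f^T != 0.
  apply/existsP; apply: contraNT Gf0 => /existsPn h.
  rewrite -PGf; apply/eqP/row_matrixP => i; rewrite row0 !row_mul.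
  by apply/eqP/negPn/h.
set e := row i _ in eGf; have eA : e *m (A - al%:M) ^+ m = 0.
  by rewrite -row_mul (spectral_nilp AP) row0.
have al0 := lexpos_neq0 pal.
have := bracket_weight adJ eA fA1; rewrite subrr => /weight0/kerA [k [l w]].
have [k0 _] := in_bv w.
have {k0} k0 : k = 0 by apply: k0; rewrite invG bad trmx0 mulmx0 oppr0.
move: w; rewrite k0 scale0r add0r => w.
exists e, f, l => //; apply: contraNneq eGf => l0.
have : f *m ad e *m G *m v^T = 0 by rewrite w l0 scale0r !mul0mx.
rewrite invG adC linearN mulmxN opprK /= trmx_mul.
rewrite -/A -(mulmxA f) (mulmxA G).
have -> : G *m A^T = - (A *m G) by rewrite Ginv opprK.
rewrite mulNmx mulmxN !mulmxA fA -!scalemxAl -scaleNr opprK => /eqP.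
rewrite scaler_eq0 (negbTE al0) /= => /eqP fGe.
by rewrite -[e *m G *m _]trmx11 !trmx_mul trmxK Gsym mulmxA fGe.
Qed.

(** The bracket of the two ladder elements is a multiple of [v]; its trace over
    the sum of the non-negative weight spaces is computed in two ways. The
    element [e] preserves that sum and, [al] being the least positive weight,
    [f] leaves it only from weight zero. A commutator of two preserving maps has
    trace zero, so the trace comes from this boundary term alone. *)
Let sum_positive_weights al : lexpos al -> P al != 0 ->
  (forall c, lexpos c -> lexpos (al - c) -> P c = 0) ->
  \sum_(a <- s | lexpos a) a * (\rank (P a))%:R = al.
Proof.
move=> pal Pal almin; have [e [f [ga ga0 [fA eA fe]]]] := ladder pal Pal.
have fA1 : f *m (A - (- al)%:M) ^+ 1 = 0.
  by rewrite expr1 mulmxBr mul_mx_scalar fA subrr.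
have [x [y [P0xy [vy _]]]] := P0E.
pose Pp := \sum_(a <- s | lexpos a) P a; pose Q := P 0 + Pp.
have Qfix k l (X : 'M[C]_(k, n.+1)) c : (c == 0) || lexpos c ->
    X *m (A - c%:M) ^+ l = 0 -> X *m Q = X.
  move=> c0 Xc; rewrite mulmxDr mulmx_sumr.
  have [e0|c1] := eqVneq c 0.
    rewrite e0 in Xc; rewrite (spectral_fix AP Xc) big1 ?addr0 // => a pa.
    by rewrite (spectral_kill AP Xc) // lexpos_neq0.
  rewrite (spectral_kill AP Xc) 1?eq_sym // add0r -big_filter.
  have pc : lexpos c by move: c0; rewrite (negbTE c1).
  rewrite -[RHS](spectral_fix AP Xc).
  have [cs|cs] := boolP (c \in s); last first.
    rewrite (spectral_out AP cs) mulmx0 big_filter big_seq_cond big1 // => a.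
    case/andP => as_ _; apply: (spectral_kill AP Xc).
    by apply: contraNneq cs => <-.
  rewrite (bigD1_seq c) ?mem_filter ?pc ?filter_uniq ?(spectral_uniq AP) //=.
  by rewrite big1 ?addr0 // => a ac; rewrite (spectral_kill AP Xc).
have Qkill k l (X : 'M[C]_(k, n.+1)) c : lexpos (- c) ->
    X *m (A - c%:M) ^+ l = 0 -> X *m Q = 0.
  move=> nc Xc; rewrite mulmxDr mulmx_sumr (spectral_kill AP Xc); last first.
    by apply: contraTneq nc => <-; rewrite oppr0 lexpos0.
  rewrite big1 ?addr0 // => a pa; rewrite (spectral_kill AP Xc) //.
  by apply: contraTneq nc => <-; rewrite lexposN.
have wE k (X : 'M[C]_(k, n.+1)) c := bracket_weight adJ (X := X) (b := c) eA.
have wF k (X : 'M[C]_(k, n.+1)) c := bracket_weight adJ (X := X) (b := c) fA1.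
(* [e] preserves the sum of the non-negative weight spaces *)
have QE : Q *m ad e *m Q = Q *m ad e.
  rewrite !mulmxDl !mulmx_suml; congr (_ + _); last first.
    apply: eq_bigr => a pa; have := wE _ _ _ _ (spectral_nilp AP a).
    by apply: Qfix; rewrite lexposD ?orbT.
  by apply: Qfix (wE _ _ _ _ (spectral_nilp AP 0)); rewrite addr0 pal orbT.
(* [f] maps positive weights to non-negative ones, and weight zero out of them *)
have QF : Q *m ad f = P 0 *m ad f + Q *m ad f *m Q.
  rewrite {1 2}/Q !mulmxDl; congr (_ + _).
  rewrite (Qkill _ _ (P 0 *m ad f) _ _ (wF _ _ _ _ (spectral_nilp AP 0))).
    rewrite add0r !mulmx_suml; apply: eq_bigr => a pa.
    have := wF _ _ _ _ (spectral_nilp AP a).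
    set X := P a *m _; set c := - al + a; set l := (_ + _)%N => Xc.
    have := lexposP c; rewrite orbA => /orP [c0|nc].
      by rewrite (Qfix _ _ _ _ c0 Xc).
    suff Pc : P c = 0 by rewrite -(spectral_fix AP Xc) Pc !mulmx0 mul0mx.
    apply/eqP; rewrite -PN0; apply/eqP/almin => //.
    by rewrite opprK addNKr.
  by rewrite addr0 opprK.
have Fe : P 0 *m ad f *m ad e = (al * ga) *: (y *m v).
  rewrite P0xy !mulmxDl -(mulmxA x) bad mulmx0 mul0mx add0r.
  rewrite -(mulmxA y) adC -/A fA scaleNr opprK -scalemxAr -scalemxAl.
  by rewrite -(mulmxA y) fe -scalemxAr scalerA.
have trFE : \tr (Q *m (ad f *m ad e - ad e *m ad f)) = al * ga.
  rewrite mulmxBr raddfB /= !mulmxA QF mulmxDl mxtraceD Fe mxtraceZ.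
  rewrite mxtrace_mulC vy mxtrace_scalar mulr1n mulr1.
  rewrite -QE.
  have -> : \tr (Q *m ad e *m Q *m ad f) = \tr (Q *m ad f *m Q *m ad e).
    by rewrite -!mulmxA mxtrace_mulC -!mulmxA mxtrace_mulC -!mulmxA.
  by rewrite addrK.
have := trFE; rewrite -adJ fe linearZ /= -/A -scalemxAr mxtraceZ mulrC.
move=> /(mulIf ga0) <-; rewrite mulmxDl P0A add0r mulmx_suml raddf_sum /=.
by apply: eq_bigr => a _; rewrite (mxtrace_spectral AP).
Qed.

(** The positive weights, counted with multiplicities, add up to the least of
    them. So there is only one, it is simple, and with its opposite and the
    two-dimensional weight space of zero it fills the algebra. *)
Lemma rank_one_matrix_dim : n.+1 = 4%N.
Proof.
have [al [pal Pal almin]] := least_weight.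
have sumal := sum_positive_weights pal Pal almin.
have [x [y [_ [_ trP0]]]] := P0E.
have inS a : P a != 0 -> a \in s.
  by apply: contraNT => /(spectral_out AP) ->.
have r0 : \rank (P 0) = 2%N.
  apply/eqP; rewrite -(eqr_nat C) -(mxtrace_idem (spectral_idem AP 0)) trP0.
  by [].
have rpos a : a \in s -> lexpos a -> \rank (P a) = (a == al).
  move=> as_ pa; pose k c := if c == al then (\rank (P c)).-1 else \rank (P c).
  have kE c : c == al -> (\rank (P c))%:R = 1 + (k c)%:R :> C.
    move=> /eqP ->; rewrite /k eqxx nat1r prednK //.
    by rewrite lt0n mxrank_eq0.
  have k0 : \sum_(c <- s | lexpos c) c * (k c)%:R = 0.
    apply: (addrI al); rewrite addr0 -[RHS]sumal -!(big_filter s).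
    have alf : al \in [seq c <- s | lexpos c] by rewrite mem_filter pal inS.
    rewrite !(bigD1_seq al alf) ?filter_uniq ?(spectral_uniq AP) //=.
    rewrite addrA kE // mulrDr mulr1; congr (_ + _).
    by apply: eq_bigr => c /negbTE c_al; rewrite /k c_al.
  move: k0; rewrite -big_filter => /lexpos_sum_eq0 k0.
  have {k0} : a * (k a)%:R = 0.
    apply: k0; last by rewrite mem_filter pa.
    move=> c; rewrite mem_filter => /andP [pc _].
    have [->|kc] := posnP (k c); first by left; rewrite mulr0.
    by right; apply: lexpos_natmul.
  move/eqP; rewrite mulf_eq0 (negbTE (lexpos_neq0 pa)) /= pnatr_eq0 /k.
  case: (eqVneq a al) => [->|_ /eqP -> //].
  have : (0 < \rank (P al))%N by rewrite lt0n mxrank_eq0.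
  by case: (\rank (P al)) => [|[|]].
have rE a : a \in s ->
    \rank (P a) = ((a == 0%R) * 2 + (a == al) + (a == - al)%R)%N.
  move=> as_; have al0 := lexpos_neq0 pal.
  have := lexposP a; have [->|a0] := eqVneq a 0.
    by rewrite r0 eq_sym (negbTE al0) eq_sym oppr_eq0 (negbTE al0).
  move=> /= /orP [] pa.
    rewrite rpos // -[a == - al]eqr_opp opprK; case: eqVneq => /= _.
      case: eqVneq => // e; move: (lexposN pa); rewrite e pal //.
    by case: eqVneq => // e; move: (lexposN pa); rewrite e pal.
  have -> : (a == al) = false.
    by apply/eqP => e; move: (lexposN pal); rewrite -e pa.
  rewrite -rankN /= !add0n -eqr_oppLR.
  have [na|na] := boolP (- a \in s); first by rewrite rpos.
  rewrite (spectral_out AP na) mxrank0; case: eqVneq => // e.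
  by rewrite e inS in na.
apply/eqP; rewrite -(eqr_nat C) -mxtrace1 -(spectral_sum AP) raddf_sum /=.
under eq_bigr => a _ do rewrite (mxtrace_idem (spectral_idem AP a)).
rewrite -natr_sum eqr_nat; apply/eqP.
rewrite (eq_big_seq (fun a : C => (a == 0%R) * 2 + (a == al) + (a == - al)%R)%N) //.
rewrite !big_split /= -big_distrl /=.
have cnt c : P c != 0 -> (\sum_(a <- s) (a == c))%N = 1%N.
  move=> /inS cs; rewrite (bigD1_seq c) ?(spectral_uniq AP) //= eqxx.
  by rewrite big1 // => a /negbTE ->.
by rewrite !cnt ?PN0 // -mxrank_eq0 r0.
Qed.

End RankOne.

(** * Coordinates and the trace form *)

Section LieArithmetic.
Variables (F : fieldType) (g : lieAlgType F).
Implicit Types x y z : g.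

Lemma lieDl x y z : lie (x + y) z = lie x z + lie y z.
Proof. by have := (lie_bilinear (s := g)).1 z 1 x y; rewrite /= !scale1r. Qed.

Lemma lieDr x y z : lie x (y + z) = lie x y + lie x z.
Proof. exact: raddfD. Qed.

Lemma lie0l x : lie 0 x = 0.
Proof. by apply: (addrI (lie 0 x)); rewrite -lieDl !addr0. Qed.

Lemma lie0r x : lie x 0 = 0. Proof. exact: raddf0. Qed.

Lemma lieZl a x y : lie (a *: x) y = a *: lie x y.
Proof.
by have := (lie_bilinear (s := g)).1 y a x 0; rewrite /= !addr0 lie0l addr0.
Qed.

Lemma lieZr a x y : lie x (a *: y) = a *: lie x y.
Proof. exact: linearZ. Qed.

Lemma lieNl x y : lie (- x) y = - lie x y.
Proof. by rewrite -scaleN1r lieZl scaleN1r. Qed.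

Lemma lieNr x y : lie x (- y) = - lie x y.
Proof. exact: raddfN. Qed.

Lemma lieC x y : lie x y = - lie y x.
Proof.
apply/eqP; rewrite -addr_eq0; have := liexx (x + y).
by rewrite lieDl !lieDr !liexx add0r addr0 => ->.
Qed.

Lemma lie_der x y z : lie x (lie y z) = lie (lie x y) z + lie y (lie x z).
Proof.
apply/subr0_eq; rewrite (lieC (lie x y) z) (lieC x z) lieNr opprD !opprK.
by apply: etrans (jacobi x y z); rewrite [in LHS](addrC (lie z _)) addrA.
Qed.

Lemma lie_suml (I : Type) (r : seq I) (P : pred I) (f : I -> g) y :
  lie (\sum_(i <- r | P i) f i) y = \sum_(i <- r | P i) lie (f i) y.
Proof.
by apply: (big_morph (fun x => lie x y)) => [? ?|]; rewrite (lieDl, lie0l).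
Qed.

Lemma lie_sumr (I : Type) (r : seq I) (P : pred I) (f : I -> g) y :
  lie y (\sum_(i <- r | P i) f i) = \sum_(i <- r | P i) lie y (f i).
Proof. exact: raddf_sum. Qed.

End LieArithmetic.

Section Coordinates.
Variables (F : fieldType) (g : lieAlgType F) (n : nat) (e : n.+1.-tuple g).
Hypothesis eB : basis_of fullv e.

Definition coords (x : g) : 'rV[F]_n.+1 := \row_i coord e i x.
Definition of_coords (u : 'rV[F]_n.+1) : g := \sum_i u 0 i *: e`_i.

Lemma coordsK x : of_coords (coords x) = x.
Proof.
rewrite [RHS](coord_basis eB (memvf x)); apply: eq_bigr => i _.
by rewrite mxE.
Qed.

Lemma of_coordsK u : coords (of_coords u) = u.
Proof.
apply/rowP => j; rewrite mxE; exact: coord_sum_free (basis_free eB).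
Qed.

Lemma coordsP a x y : coords (a *: x + y) = a *: coords x + coords y.
Proof. by apply/rowP => j; rewrite !mxE linearP. Qed.

HB.instance Definition _ := GRing.isLinear.Build F g 'rV[F]_n.+1 _ coords coordsP.

(** The matrix of [lie x] acting on row vectors from the right. *)
Definition ad_mx (x : g) : 'M[F]_n.+1 := \matrix_(i, j) coord e j (lie x e`_i).

Lemma ad_mxP a x y : ad_mx (a *: x + y) = a *: ad_mx x + ad_mx y.
Proof. by apply/matrixP => i j; rewrite !mxE lieDl lieZl linearP. Qed.

HB.instance Definition _ := GRing.isLinear.Build F g 'M[F]_n.+1 _ ad_mx ad_mxP.

Lemma mul_coords_ad x y : coords y *m ad_mx x = coords (lie x y).
Proof.
apply/rowP => j; rewrite !mxE -{2}(coordsK y) lie_sumr linear_sum /=.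
by apply: eq_bigr => i _; rewrite !mxE lieZr linearZ.
Qed.

Lemma coords_mx_ext k (M N : 'M[F]_(n.+1, k)) :
  (forall x, coords x *m M = coords x *m N) -> M = N.
Proof.
by move=> MN; apply/row_matrixP => i; rewrite !rowE -(of_coordsK (delta_mx 0 i)) MN.
Qed.

Lemma ad_mx_lie x y : ad_mx (lie x y) = ad_mx y *m ad_mx x - ad_mx x *m ad_mx y.
Proof.
apply: coords_mx_ext => z; rewrite mulmxBr !mulmxA !mul_coords_ad -raddfB /=.
by rewrite lie_der addrK.
Qed.

Lemma coords_ad_iter x y k : coords y *m ad_mx x ^+ k = coords (iter k (lie x) y).
Proof.
elim: k => [|k IHk]; first by rewrite mulmx1.
by rewrite exprSr -mulmxE mulmxA IHk mul_coords_ad.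
Qed.

(** The Killing form. *)
Definition trace_form (x y : g) : F := \tr (ad_mx x *m ad_mx y).

Lemma trace_formC x y : trace_form x y = trace_form y x.
Proof. exact: mxtrace_mulC. Qed.

Lemma trace_form_bilinear : bilinear_for *%R *%R trace_form.
Proof.
split=> x a y z; rewrite /trace_form linearP /=.
  by rewrite mulmxDl -scalemxAl raddfD /= mxtraceZ.
by rewrite mulmxDr -scalemxAr raddfD /= mxtraceZ.
Qed.

HB.instance Definition _ :=
  bilinear_isBilinear.Build F g g F *%R *%R trace_form trace_form_bilinear.

Lemma trace_form_inv x y z :
  trace_form (lie x y) z + trace_form y (lie x z) = 0.
Proof.
rewrite /trace_form !ad_mx_lie mulmxBl mulmxBr !raddfB /= !mulmxA.
rewrite [\tr (ad_mx y *m _ *m _)]mxtrace_mulC -(mulmxA (ad_mx x)).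
rewrite [\tr (ad_mx y *m ad_mx z *m _)]mxtrace_mulC mulmxA.
by rewrite [\tr (ad_mx x *m ad_mx y *m _)]mxtrace_mulC; ring.
Qed.

End Coordinates.

(** * Complexification *)

Lemma span_ind (F : fieldType) (V : vectType F) (X : seq V) (P : V -> Prop) :
  P 0 -> (forall a x y, P x -> P y -> P (a *: x + y)) ->
  (forall x, x \in X -> P x) -> forall x, x \in <<X>>%VS -> P x.
Proof.
move=> P0 PD PX x xX; rewrite (coord_span (X := in_tuple X) xX).
apply: (big_ind P) => // [y z Py Pz|i _]; first by rewrite -[y]scale1r; apply: PD.
by rewrite -[_ *: _]addr0; apply: PD => //; apply/PX/mem_nth.
Qed.

Section Complexification.
Variables (R : rcfType) (g : lieAlgType R) (n : nat) (e : n.+1.-tuple g).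
Hypothesis eB : basis_of fullv e.
Let C : numClosedFieldType := R[i].
Let cx : {rmorphism R -> C} := real_complex R.
Let mx k l (M : 'M[R]_(k, l)) : 'M[C]_(k, l) := map_mx cx M.
Let rv := coords e.
Let adm := ad_mx e.

(** The adjoint matrices of the complexification of [g], whose elements are
    the complex row vectors. *)
Definition ad_complex (u : 'rV[R[i]]_n.+1) : 'M[R[i]]_n.+1 :=
  \sum_i u 0 i *: map_mx (real_complex R) (ad_mx e e`_i).

Lemma ad_complex_linear : linear ad_complex.
Proof.
move=> a u w; rewrite /ad_complex scaler_sumr -big_split /=; apply: eq_bigr => i _.
by rewrite !mxE scalerA scalerDl.
Qed.

HB.instance Definition _ :=
  GRing.isLinear.Build R[i] 'rV[R[i]]_n.+1 'M[R[i]]_n.+1 _ ad_complex ad_complex_linear.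

Let rv_e (i : 'I_n.+1) : rv e`_i = delta_mx 0 i.
Proof.
apply/rowP => j; rewrite !mxE coord_free ?(basis_free eB) //.
by rewrite eqxx eq_sym.
Qed.

Lemma ad_complex_real x : ad_complex (mx (rv x)) = mx (adm x).
Proof.
rewrite -[in RHS](coordsK eB x) /of_coords /adm linear_sum /mx [RHS]raddf_sum.
apply: eq_bigr => i _.
by rewrite linearZ /= map_mxZ mxE.
Qed.

Let decompC (u : 'rV[C]_n.+1) : u = \sum_i u 0 i *: mx (rv e`_i).
Proof.
rewrite {1}[u]row_sum_delta; apply: eq_bigr => i _.
by rewrite rv_e /mx map_delta_mx.
Qed.

Let mul_real x y : mx (rv y) *m ad_complex (mx (rv x)) = mx (rv (lie x y)).
Proof. by rewrite ad_complex_real -map_mxM mul_coords_ad. Qed.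

Let ad_complexE (u : 'rV[C]_n.+1) :
  ad_complex u = \sum_i u 0 i *: ad_complex (mx (rv e`_i)).
Proof. by apply: eq_bigr => i _; rewrite ad_complex_real. Qed.

Lemma ad_complexC u w : u *m ad_complex w = - (w *m ad_complex u).
Proof.
have real x u' : u' *m ad_complex (mx (rv x)) = - (mx (rv x) *m ad_complex u').
  rewrite [in LHS](decompC u') (ad_complexE u') mulmx_suml mulmx_sumr -sumrN.
  apply: eq_bigr => i _.
  by rewrite -scalemxAl -scalemxAr -scalerN !mul_real lieC [rv (- _)]raddfN /mx map_mxN.
rewrite (ad_complexE w) [in RHS](decompC w) mulmx_suml mulmx_sumr -sumrN.
by apply: eq_bigr => i _; rewrite -scalemxAl -scalemxAr real scalerN.
Qed.

Lemma ad_complexJ u w : ad_complex (w *m ad_complex u) =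
  ad_complex w *m ad_complex u - ad_complex u *m ad_complex w.
Proof.
have real x w' : ad_complex (w' *m ad_complex (mx (rv x))) =
    ad_complex w' *m ad_complex (mx (rv x)) - ad_complex (mx (rv x)) *m ad_complex w'.
  rewrite [in LHS](decompC w') mulmx_suml linear_sum [in RHS](ad_complexE w').
  rewrite mulmx_suml mulmx_sumr -sumrB.
  apply: eq_bigr => j _; rewrite -!scalemxAl [LHS]linearZ /= -scalemxAr -scalerBr.
  by rewrite mul_real !ad_complex_real -!map_mxM -map_mxB -ad_mx_lie.
rewrite (ad_complexE u) mulmx_sumr [LHS]linear_sum mulmx_sumr mulmx_suml -sumrB.
apply: eq_bigr => i _; rewrite -!scalemxAr [LHS]linearZ /= real.
by rewrite -scalemxAl -scalerBr.
Qed.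

Lemma trace_ad_complex (x : g) (u : 'rV[C]_n.+1) :
  (forall y, trace_form e x y = 0) -> \tr (ad_complex (mx (rv x)) *m ad_complex u) = 0.
Proof.
move=> x0; rewrite (ad_complexE u) mulmx_sumr raddf_sum big1 //= => i _.
rewrite -scalemxAr mxtraceZ !ad_complex_real -map_mxM trace_map_mx.
by rewrite [\tr _]x0 rmorph0 mulr0.
Qed.

(** Cartan's criterion on the radical of the trace form. Weights need complex
    scalars, but the hypothesis and the conclusion concern real matrices. *)
Lemma trace_form_ad_nilpotent (X : seq g) x :
  (forall z, z \in X -> exists a c, z = lie a c /\ forall y, trace_form e a y = 0) ->
  x \in <<X>>%VS -> exists k, forall y, iter k (lie x) y = 0.
Proof.
move=> XP xX.
have [D [Dbr Dx]] := conjugate_derivation ad_complexJ (mx (rv x)).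
have [|k xk] := Dx; last first.
  exists k => y; rewrite -[LHS](coordsK eB) -(coords_ad_iter eB).
  have -> : adm x ^+ k = 0; last first.
    by rewrite mulmx0 /of_coords big1 // => i _; rewrite mxE scale0r.
  apply: (map_mx_inj (f := cx)); rewrite map_mx0 rmorphXn /=.
  by rewrite -[map_mx _ _]ad_complex_real.
pose T := fun z => \tr (ad_complex (mx (rv z)) *m D) = 0.
rewrite -/(T x); apply: (span_ind _ _ _ xX); rewrite /T.
- by rewrite /rv raddf0 /mx map_mx0 raddf0 mul0mx mxtrace0.
- move=> a y z Ty Tz; rewrite /rv coordsP /mx map_mxD map_mxZ linearP /=.
  by rewrite mulmxDl -scalemxAl raddfD /= mxtraceZ Ty Tz mulr0 addr0.
move=> z /XP [a [c [-> a0]]]; rewrite -mul_real.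
by apply: Dbr => u; apply: trace_ad_complex.
Qed.

(** Non-degeneracy of the form and the centralizer of [v] are both expressed by
    ranks of real matrices, so they survive complexification. *)
Lemma rank_one_dim (B : {biscalar g}) (b v : g) :
  (forall x y, B x y = B y x) ->
  (forall x, (forall y, B x y = 0) -> x = 0) ->
  (forall x y z, B (lie x y) z + B y (lie x z) = 0) ->
  central b -> B b b != 0 -> B v v != 0 -> B b v = 0 ->
  (forall x, lie v x = 0 -> exists k l, x = k *: b + l *: v) ->
  ~ central v -> n.+1 = 4%N.
Proof.
move=> Bsym Bnd Binv cb bb vv bv kerv ncv.
pose G : 'M[R]_n.+1 := \matrix_(i, j) B e`_i e`_j.
have BG x y : rv x *m G *m (rv y)^T = (B x y)%:M.
  apply/matrixP => i0 j0; rewrite (ord1 i0) (ord1 j0) !mxE mulr1n.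
  rewrite -[in RHS](coordsK eB y) /of_coords linear_sumr /=; apply: eq_bigr => k _.
  rewrite !mxE linearZr_LR /= mulrC; congr (_ * _).
  rewrite -[in RHS](coordsK eB x) /of_coords linear_sumlz /=; apply: eq_bigr => l _.
  by rewrite !mxE linearZl_LR.
have Gsym : (mx G)^T = mx G.
  by rewrite /mx map_trmx; congr map_mx; apply/matrixP => i j; rewrite !mxE.
have Gfree : row_free (mx G).
  rewrite row_free_map; apply: inj_row_free => u uG.
  rewrite -(of_coordsK eB u) (Bnd (of_coords e u)) ?raddf0 // => y.
    have := BG (of_coords e u) y; rewrite /rv of_coordsK // uG mul0mx.
  by move/matrixP/(_ 0 0); rewrite !mxE mulr1n.
have Ginv u : ad_complex u *m mx G = - (mx G *m (ad_complex u)^T).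
  have real x : adm x *m G = - (G *m (adm x)^T).
    apply: (coords_mx_ext eB) => y; apply/trmx_inj/(coords_mx_ext eB) => z.
    apply: trmx_inj; rewrite -/rv [LHS]trmx_mul [RHS]trmx_mul !trmxK.
    rewrite mulmxA mul_coords_ad // BG mulmxN mulNmx.
    rewrite -!mulmxA -trmx_mul mulmxA mul_coords_ad // BG -raddfN /=.
    by congr (_%:M); apply/eqP; rewrite -addr_eq0 Binv.
  rewrite ad_complexE mulmx_suml [(\sum__ _)^T]raddf_sum /= mulmx_sumr -sumrN.
  apply: eq_bigr => i _; rewrite [(_ *: _)^T]linearZ /= -scalemxAl -scalemxAr -scalerN.
  congr (_ *: _); rewrite ad_complex_real /mx map_trmx -!map_mxM -map_mxN.
  by congr map_mx; exact: real.
have adb : ad_complex (mx (rv b)) = 0.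
  rewrite ad_complex_real; suff -> : adm b = 0 by exact: map_mx0.
  by apply: (coords_mx_ext eB) => y; rewrite mul_coords_ad // cb mulmx0 raddf0.
have ker u : u *m ad_complex (mx (rv v)) = 0 ->
    exists k l, u = k *: mx (rv b) + l *: mx (rv v).
  rewrite ad_complex_real => /sub_kermxP; rewrite /mx -map_kermx => ukv.
  have sub : (kermx (adm v) <= rv b + rv v)%MS.
    apply/row_subP => i; set w := row i _.
    have : rv (lie v (of_coords e w)) = 0.
      by rewrite /rv -mul_coords_ad // of_coordsK // -row_mul mulmx_ker row0.
    move/(congr1 (of_coords e)); rewrite coordsK //.
    have -> : of_coords e 0 = 0 by rewrite /of_coords big1 // => j _; rewrite mxE scale0r.
    move=> /kerv [k [l]] /(congr1 rv); rewrite /rv of_coordsK // => ->.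
    by rewrite linearP /= linearZ addmx_sub_adds ?scalemx_sub.
  move: sub; rewrite -(map_submx cx) map_addsmx => /(submx_trans ukv).
  move=> /sub_addsmxP [[k l] /= ->]; exists (k 0 0), (l 0 0).
  by rewrite [k]mx11_scalar [l]mx11_scalar !mul_scalar_mx !mxE.
have BC x y : mx (rv x) *m mx G *m (mx (rv y))^T = (cx (B x y))%:M.
  by rewrite /mx map_trmx -!map_mxM BG map_scalar_mx.
have BC0 x : B x x != 0 -> mx (rv x) *m mx G *m (mx (rv x))^T != 0.
  move=> xx; rewrite BC; apply: contra xx => /eqP/matrixP/(_ 0 0).
  by rewrite !mxE mulr1n => /eqP; rewrite fmorph_eq0.
have [s [P [m AP]]] := spectral_family_exists (ad_complex (mx (rv v))).
apply: (rank_one_matrix_dim ad_complexC ad_complexJ Gsym Gfree Ginv adb ker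
  (BC0 b bb) (BC0 v vv) _ _ AP).
  by rewrite BC bv rmorph0; apply: raddf0.
apply/eqP => av; apply: ncv => y.
have : rv (lie v y) = 0.
  rewrite /rv -mul_coords_ad //; suff -> : ad_mx e v = 0 by rewrite mulmx0.
  by apply: (map_mx_inj (f := cx)); rewrite map_mx0; apply: etrans av;
    apply/esym/ad_complex_real.
move/(congr1 (of_coords e)); rewrite coordsK // => ->.
by rewrite /of_coords big1 // => j _; rewrite mxE scale0r.
Qed.
End Complexification.

(** * Engel's theorem and reductive algebras *)

Section Engel.
Variables (F : fieldType) (g : lieAlgType F).
Implicit Types M H U A B : {vspace g}.

Definition ad_nilpotent (x : g) := exists k, forall y, iter k (lie x) y = 0.

Definition lie_stable M U := forall x y, x \in M -> y \in U -> lie x y \in U.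

(** The conclusion of Engel's theorem for the adjoint action of [M], relative to
    a pair of stable subspaces. This version passes from a subalgebra to one
    that is larger by one dimension. *)
Definition engel M := forall A B, (A <= B)%VS -> ~~ (B <= A)%VS ->
  lie_stable M A -> lie_stable M B ->
  exists y, [/\ y \in B, y \notin A & forall m, m \in M -> lie m y \in A].

(** The property of [M], applied inside [H] modulo [M] itself, yields [x] that
    normalizes [M]. If [M] maps [y] into [A], it does the same to all iterates of
    [y] under [lie x]; as these are eventually zero, the last one outside [A] is
    mapped into [A] by [x] too. *)
Lemma engel_extend M H : (M <= H)%VS -> ~~ (H <= M)%VS ->
  lie_stable M M -> lie_stable H H -> (forall x, x \in H -> ad_nilpotent x) ->
  engel M -> exists M', [/\ (M' <= H)%VS, (\dim M < \dim M')%N,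
    lie_stable M' M' & engel M'].
Proof.
move=> MH HM sM sH nilH eM.
have [x [xH xM Mx]] : exists x, [/\ x \in H, x \notin M &
    forall m, m \in M -> lie m x \in M].
  by apply: eM => // y z /(subvP MH) yH zH; apply: sH.
have inM y : y \in (M + <[x]>)%VS -> exists2 m, m \in M & exists k, y = m + k *: x.
  by case/memv_addP => m mM [_ /vlineP [k ->] ->]; exists m => //; exists k.
exists (M + <[x]>)%VS; split.
- by rewrite subv_add MH -memvE.
- rewrite ltnNge; apply: contra xM => le.
  have /eqP -> : M == (M + <[x]>)%VS by rewrite eqEdim addvSl.
  exact: (subvP (addvSr _ _)) (memv_line x).
- move=> _ _ /inM [m mM [k ->]] /inM [m' mM' [k' ->]].
  apply: (subvP (addvSl _ _)); rewrite lieDl !lieDr !lieZl !lieZr liexx !scaler0.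
  by rewrite addr0 [lie x m']lieC !rpredD ?rpredZ ?rpredN ?Mx ?sM.
move=> A B AB BA sA sB.
have sub U : lie_stable (M + <[x]>) U -> lie_stable M U /\
    forall y, y \in U -> lie x y \in U.
  move=> sU; split=> [m y mM|y]; apply: sU.
    exact: (subvP (addvSl _ _)).
  exact/(subvP (addvSr _ _))/memv_line.
have [[sMA sxA] [sMB sxB]] := (sub _ sA, sub _ sB).
have [y [yB yA My]] := eM A B AB BA sMA sMB.
have itB j : iter j (lie x) y \in B by elim: j => //= j; apply: sxB.
have itA j m : m \in M -> lie m (iter j (lie x) y) \in A.
  elim: j m => [|j IHj] m mM /=; first exact: My.
  by rewrite lie_der rpredD ?IHj ?Mx // sxA ?IHj.
have [k xk] := nilH x xH.
have [j yj yj1] : exists2 j, iter j (lie x) y \notin A &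
    lie x (iter j (lie x) y) \in A.
  have: iter k (lie x) y \in A by rewrite xk mem0v.
  elim: k {xk} => [|k IHk] /=; first by rewrite (negbTE yA).
  by have [/IHk //|kA k1A] := boolP (iter k (lie x) y \in A); exists k.
exists (iter j (lie x) y); split=> // _ /inM [m mM [l ->]].
by rewrite lieDl lieZl; apply: rpredD; [apply: itA|apply: rpredZ].
Qed.

Lemma engel_theorem H : lie_stable H H ->
  (forall x, x \in H -> ad_nilpotent x) -> engel H.
Proof.
move=> sH nilH.
suff grow l M : (M <= H)%VS -> (\dim H - \dim M <= l)%N -> lie_stable M M ->
    engel M -> engel H.
  apply: (grow (\dim H) 0%VS); rewrite ?sub0v ?leq_subr //.
    by move=> x y _; rewrite memv0 => /eqP ->; rewrite lie0r mem0v.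
  move=> A B _ /subvPn [y yB yA] _ _; exists y; split=> // m.
  by rewrite memv0 => /eqP ->; rewrite lie0l mem0v.
elim: l M => [|l IHl] M MH dl sM eM.
  suff <- : M = H by [].
  by apply/eqP; rewrite eqEdim MH -subn_eq0 -leqn0.
have [HM|HM] := boolP (H <= M)%VS.
  by suff <- : M = H by []; apply/eqP; rewrite eqEsubv MH.
have [M' [M'H dM' sM' eM']] := engel_extend MH HM sM sH nilH eM.
apply: (IHl M') => //; rewrite !leq_subLR in dl *; apply: leq_trans dl _.
by rewrite addnS -addSn leq_add2r.
Qed.

End Engel.

Section Derived.
Variables (F : fieldType) (g : lieAlgType F).

Definition lie_products (U V : {vspace g}) : seq g :=
  [seq lie x y | x <- vbasis U, y <- vbasis V].

Lemma mem_lie_products (U V : {vspace g}) x y :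
  x \in U -> y \in V -> lie x y \in <<lie_products U V>>%VS.
Proof.
move=> /coord_vbasis -> /coord_vbasis ->; rewrite lie_suml memv_suml // => i _.
rewrite lieZl lie_sumr rpredZ // memv_suml // => j _; rewrite lieZr rpredZ //.
by apply/memv_span/allpairs_f; apply/mem_nth; rewrite size_tuple.
Qed.

Definition derived_algebra : {vspace g} := <<lie_products fullv fullv>>.

Lemma lie_derived x y : lie x y \in derived_algebra.
Proof. by apply: mem_lie_products; apply: memvf. Qed.

Lemma derived_sub (U : {vspace g}) :
  (forall x y, lie x y \in U) -> (derived_algebra <= U)%VS.
Proof. by move=> h; apply/span_subvP => _ /allpairsP [[x y] [_ _ ->]]. Qed.

Lemma line_ideal (z : g) : central z -> lie_ideal <[z]>%VS.
Proof.
move=> cz x _ /vlineP [k ->].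
by rewrite lieZr lieC cz oppr0 scaler0 mem0v.
Qed.

Hypothesis gR : reductive g.

(** A bracket with an element of a complementary ideal lies in both ideals. *)
Lemma reductive_split : exists2 K : {vspace g},
  (derived_algebra + K = fullv)%VS & forall z, z \in K -> central z.
Proof.
have [|K Kid [sum cap]] := gR (I := derived_algebra).
  by move=> x y _; apply: lie_derived.
exists K => // z zK y; apply/eqP; rewrite -memv0 -cap memv_cap lie_derived.
by rewrite lieC rpredN Kid.
Qed.

(** The line spanned by a central element has a complementary ideal, which
    already contains every bracket. *)
Lemma central_derived (z : g) : central z -> z \in derived_algebra -> z = 0.
Proof.
move=> cz zD; have [K Kid [sum cap]] := gR (line_ideal cz).
apply/eqP; rewrite -memv0 -cap memv_cap memv_line.
apply: (subvP (derived_sub _)) zD => x y.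
have split u : exists2 k, k \in K & exists a, u = a *: z + k.
  have : u \in (<[z]> + K)%VS by rewrite sum memvf.
  by case/memv_addP => _ /vlineP [a ->] [k kK ->]; exists k => //; exists a.
have [[x' xK [a ->]] [y' yK [c ->]]] := (split x, split y).
rewrite lieDl lieZl cz scaler0 add0r lieDr lieZr [lie _ z]lieC cz oppr0 scaler0.
by rewrite add0r Kid.
Qed.

End Derived.

Section TraceRadical.
Variables (R : rcfType) (g : lieAlgType R) (n : nat) (e : n.+1.-tuple g).
Hypothesis eB : basis_of fullv e.
Hypothesis gR : reductive g.

Let T (x : g) : 'rV[R]_n.+1 := \row_j trace_form e x e`_j.

Let T_linear : linear T.
Proof.
by move=> a x y; apply/rowP => j; rewrite !mxE linearDl linearZl_LR.
Qed.

HB.instance Definition _ := GRing.isLinear.Build R g 'rV[R]_n.+1 _ T T_linear.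

Let memT x : reflect (forall y, trace_form e x y = 0) (x \in lker (linfun T)).
Proof.
rewrite memv_ker lfunE; apply: (iffP eqP) => /= [/rowP Tx y|Tx]; last first.
  by apply/rowP => j; rewrite !mxE.
rewrite -(coordsK eB y) /of_coords linear_sumr big1 // => i _; rewrite linearZr_LR /=.
by have := Tx i; rewrite !mxE => ->; rewrite mulr0.
Qed.

(** The part [I] of the radical inside the derived algebra is an ideal with a
    complementary ideal, so it is spanned by its own brackets with [g]. By
    Cartan's criterion its elements are ad-nilpotent; by Engel's theorem [I], if
    nonzero, contains a nonzero element that commutes with [I], hence with [g].
    No such element exists in the derived algebra. *)
Lemma trace_form_derived x :
  x \in derived_algebra g -> (forall y, trace_form e x y = 0) -> x = 0.
Proof.
pose I := (derived_algebra g :&: lker (linfun T))%VS.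
move=> xD x0; have : x \in I by rewrite memv_cap xD; apply/memT.
have Iid : lie_ideal I.
  move=> y z /memv_capP [zD /memT z0]; rewrite memv_cap lie_derived.
  apply/memT => u; have := trace_form_inv eB y z u.
  by rewrite z0 addr0.
have [J Jid [IJ cap]] := gR Iid.
have mulI y z : y \in I -> lie y z \in I.
  by move=> yI; rewrite lieC rpredN Iid.
have perfectI z : z \in I -> z \in <<lie_products I fullv>>%VS.
  move=> zI.
  have : z \in (<<lie_products I fullv>> + J)%VS.
    have /memv_capP [zD _] := zI.
    apply: (subvP (derived_sub _)) zD => u w.
    have : u \in (I + J)%VS by rewrite IJ memvf.
    have : w \in (I + J)%VS by rewrite IJ memvf.
    case/memv_addP => w1 wI [w2 wJ ->] /memv_addP [u1 uI [u2 uJ ->]].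
    rewrite lieDl (lieDr u2) addrA memv_add ?Jid //.
    by rewrite [lie u2 w1]lieC rpredB ?mem_lie_products ?memvf.
  case/memv_addP => s sI [j jJ zE]; suff j0 : j = 0 by rewrite zE j0 addr0.
  have sI' : s \in I.
    apply: (subvP _) sI; apply/span_subvP => _ /allpairsP [[a c] [/= aI _ ->]].
    by apply/mulI/vbasis_mem.
  apply/eqP; rewrite -memv0 -cap memv_cap jJ andbT.
  by rewrite -[j](addKr s) -zE addrC rpredB.
have nilI z : z \in I -> ad_nilpotent z.
  move=> /perfectI zI; apply: (trace_form_ad_nilpotent eB _ zI) => _
    /allpairsP [[a c] [/= /vbasis_mem /memv_capP [_ /memT a0] _ ->]].
  by exists a, c.
have [I0|I0] := boolP (I <= 0)%VS.
  by move=> xI; apply/eqP; rewrite -memv0; apply: subvP xI.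
have stI : lie_stable I I by move=> y z _; apply: Iid.
have st0 : lie_stable I 0%VS.
  by move=> y z _; rewrite memv0 => /eqP ->; rewrite lie0r mem0v.
have [z [zI z0 Iz]] := engel_theorem stI nilI (sub0v I) I0 st0 stI.
case/negP: z0; rewrite memv0; apply/eqP/(central_derived gR); last first.
  by case/memv_capP: zI.
move=> y; have : y \in (I + J)%VS by rewrite IJ memvf.
case/memv_addP => y1 yI [y2 yJ ->]; rewrite lieDr lieC.
have := Iz y1 yI; rewrite memv0 => /eqP ->; rewrite oppr0 add0r.
by apply/eqP; rewrite -memv0 -cap memv_cap mulI //= Jid.
Qed.

End TraceRadical.

(** * Reductive locally conformally symplectic algebras *)

Lemma functional_represented (F : fieldType) (V : vectType F) (B : {biscalar V})
    (U : {vspace V}) (f : V -> F) :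
  (forall x, x \in U -> (forall y, y \in U -> B x y = 0) -> x = 0) ->
  (forall a x y, f (a *: x + y) = a * f x + f y) ->
  exists2 v, v \in U & forall y, y \in U -> f y = B v y.
Proof.
move=> nd fL; pose X := vbasis U.
have f_sum (I : Type) (r : seq I) (P : pred I) (c : I -> F) (h : I -> V) :
    f (\sum_(i <- r | P i) c i *: h i) = \sum_(i <- r | P i) c i * f (h i).
  have f0 : f 0 = 0.
    have := fL 1 0 0; rewrite scale1r addr0 mul1r => e.
    by apply: (addrI (f 0)); rewrite addr0 -e.
  elim: r => [|i r IHr]; rewrite ?big_nil // !big_cons.
  by case: (P i); rewrite // fL IHr.
have XU i : X`_i \in U.
  have [iX|Xi] := ltnP i (\dim U); last by rewrite nth_default ?size_tuple ?mem0v.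
  by apply/vbasis_mem/mem_nth; rewrite size_tuple.
pose G : 'M[F]_(\dim U) := \matrix_(i, j) B X`_i X`_j.
pose w : 'rV[F]_(\dim U) := \row_j f X`_j.
pose vec (u : 'rV[F]_(\dim U)) := \sum_i u 0 i *: X`_i.
have vecU u : vec u \in U by apply: memv_suml => i _; apply/rpredZ/XU.
have BG u (j : 'I_(\dim U)) : B (vec u) X`_j = (u *m G) 0 j.
  rewrite mxE linear_sumlz; apply: eq_bigr => i _.
  by rewrite mxE linearZl_LR.
have Gu : G \in unitmx.
  rewrite -row_free_unit; apply: inj_row_free => u uG.
  have vu0 : vec u = 0.
    apply: nd => // y /coord_vbasis ->; rewrite linear_sumr big1 // => i _.
    by rewrite linearZr_LR BG uG mxE /= mulr0.
  apply/rowP => j; rewrite mxE.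
  have /freeP /(_ (fun i => u 0 i)) h := basis_free (vbasisP U).
  exact: h vu0 j.
exists (vec (w *m invmx G)) => // y /coord_vbasis ->.
rewrite f_sum linear_sumr; apply: eq_bigr => i _.
by rewrite linearZr_LR /= BG mulmxKV // mxE.
Qed.

Lemma dualZ (F : fieldType) (V : vectType F) (f : 'Hom(V, F^o)) a x :
  f (a *: x) = a * f x.
Proof. exact: linearZ. Qed.

Lemma dualP (F : fieldType) (V : vectType F) (f : 'Hom(V, F^o)) a x y :
  f (a *: x + y) = a * f x + f y.
Proof. exact: linearP. Qed.

Section LeeForm.
Variables (F : fieldType) (g : lieAlgType F) (n : nat) (e : n.+1.-tuple g).
Variable lambda : 'Hom(g, F^o).

(** The trace form is degenerate along the centre. When the centre is a line on
    which [lambda] does not vanish, this correction repairs it. *)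
Definition lee_form (x y : g) : F := trace_form e x y + lambda x * lambda y.

Lemma lee_form_bilinear : bilinear_for *%R *%R lee_form.
Proof.
split=> x a y z; rewrite /lee_form.
  by rewrite linearDl linearZl_LR /= dualP; ring.
by rewrite linearDr linearZr_LR /= dualP; ring.
Qed.

HB.instance Definition _ :=
  bilinear_isBilinear.Build F g g F *%R *%R lee_form lee_form_bilinear.
End LeeForm.

Lemma alternatingC (F : fieldType) (g : lieAlgType F) (w : {biscalar g}) :
  (forall x, w x x = 0) -> forall x y, w x y = - w y x.
Proof.
move=> w0 x y; apply/eqP; rewrite -addr_eq0; have := w0 (x + y).
by rewrite linearDl !linearDr !w0 add0r addr0 /= => ->.
Qed.

(** Contraction of the identity for the differential of [omega] with [b]. As
    [b] is central, this is minus the twisted differential of [omega b]. *)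
Lemma lcs_primitive (R : realFieldType) (g : lieAlgType R) (omega : {biscalar g})
    (lambda : 'Hom(g, R^o)) (b : g) :
  lcs omega lambda -> central b -> lambda b = 1 ->
  forall x y, omega x y =
    omega b (lie x y) + lambda x * omega b y - lambda y * omega b x.
Proof.
move=> [w0 _ _ wd] cb lb x y; have wC := alternatingC w0.
have := wd b x y; rewrite /d2 /wedge12 lb cb [lie y b]lieC cb.
rewrite oppr0 !linear0l (wC (lie x y)) (wC y b) /=; lra.
Qed.

(** The functional [psi = omega b] is represented in the trace form by some [v] in
    the derived algebra. An element of the kernel of [lambda] that commutes with
    [v] has [psi] zero on its brackets, so non-degeneracy of [omega] confines it
    to the line of [r], which is that of [v]. Thus the centralizer of [v] is the
    span of [b] and [v], as [rank_one_dim] requires. *)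
Lemma lcs_reductive (R : rcfType) (g : lieAlgType R) (omega : {biscalar g})
    (lambda : 'Hom(g, R^o)) :
  reductive g -> lcs omega lambda -> (exists x y z, d2 omega x y z <> 0) ->
  exists b, [/\ central b, lambda b = 1,
    forall x, lambda x = 0 -> x \in derived_algebra g & \dim {:g} = 4%N].
Proof.
move=> gR [w0 wnd lclosed wd] [x0 [y0 [z0 dw0]]].
have lie0 x y : lambda (lie x y) = 0.
  by have /eqP := lclosed x y; rewrite /d1 oppr_eq0 => /eqP.
have lD x : x \in derived_algebra g -> lambda x = 0.
  move=> xD; suff : x \in lker lambda by rewrite memv_ker => /eqP.
  apply: (subvP (derived_sub _)) xD => y z.
  by rewrite memv_ker lie0.
have [K sumK Kc] := reductive_split gR.
have decK x : exists2 d, d \in derived_algebra g & exists2 k, k \in K & x = d + k.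
  have : x \in (derived_algebra g + K)%VS by rewrite sumK memvf.
  by case/memv_addP => d dD [k kK ->]; exists d => //; exists k.
have [b cb lb] : exists2 b, central b & lambda b = 1.
  have [l0|/eqP/lfunP l0] := eqVneq lambda 0.
    by case: dw0; rewrite wd /wedge12 l0 !lfunE /= !mul0r !addr0.
  have /subvPn [x _] : ~~ (fullv <= lker lambda)%VS.
    apply/negP => /subvP h; apply: l0 => x; rewrite lfunE /=.
    by apply/eqP; rewrite -memv_ker h ?memvf.
  have [d dD [k kK ->]] := decK x.
  rewrite memv_ker linearD /= (lD d dD) add0r => lk.
  exists ((lambda k)^-1 *: k); last by rewrite dualZ mulVf.
  by move=> y; rewrite lieZl Kc // scaler0.
pose psi := omega b.
have psiL a x y : psi (a *: x + y) = a * psi x + psi y.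
  by rewrite /psi linearDr linearZr_LR.
have wE x y : omega x y = psi (lie x y) + lambda x * psi y - lambda y * psi x.
  exact: (lcs_primitive (Build_lcs w0 wnd lclosed wd)).
have dimE : (0 < \dim {:g})%N.
  rewrite lt0n dimv_eq0; apply: contraTneq isT => f0.
  have : b \in fullv by rewrite memvf.
  rewrite f0 memv0 => /eqP b0; move: lb; rewrite b0 linear0 => /esym/eqP.
  by rewrite oner_eq0.
have [n [e eB]] : exists n, exists e : n.+1.-tuple g, basis_of fullv e.
  exists (\dim {:g}).-1; exists (tcast (esym (prednK dimE)) (vbasis {:g})).
  by rewrite val_tcast vbasisP.
have [v vD vP] : exists2 v, v \in derived_algebra g &
    forall y, y \in derived_algebra g -> psi y = trace_form e v y.
  apply: functional_represented => // x xD x0'.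
  apply: (trace_form_derived eB gR xD) => y; have [d dD [k kK ->]] := decK y.
  rewrite linearDr (x0' d dD) add0r /= trace_formC /trace_form.
  suff -> : ad_mx e k = 0 by rewrite mul0mx mxtrace0.
  by apply/matrixP => i j; rewrite !mxE Kc // linear0.
have kinv x y z : trace_form e x (lie y z) = - trace_form e (lie y x) z.
  by apply/eqP; rewrite -addr_eq0 addrC (trace_form_inv eB).
have v0 : v != 0.
  apply: contra_notN dw0 => /eqP v0.
  have psi0 x y : psi (lie x y) = 0 by rewrite vP ?lie_derived // v0 linear0l.
  by rewrite /d2 !wE !lie0 !psi0 !mul0r !mulr0 !addr0 !subr0 oppr0.
have vlie y : psi (lie v y) = 0.
  by rewrite vP ?lie_derived // kinv liexx linear0l oppr0.
have [r _ rP] : exists2 r, r \in fullv &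
    forall y, y \in fullv -> - lambda y = omega r y.
  apply: functional_represented => [x _ x0'|a x y]; last first.
    by rewrite dualP opprD mulrN.
  by apply: wnd => y; apply: x0'; apply: memvf.
have key x : lambda x = 0 -> (forall y, psi (lie x y) = 0) -> x = psi x *: r.
  move=> lx xy; apply/subr0_eq/wnd => y.
  rewrite linearBl linearZl_LR /= -rP ?memvf // wE lx xy; ring.
have of_coords := key v (lD v vD) vlie.
have psiv : psi v != 0 by apply: contraNneq v0 => e0; rewrite of_coords e0 scale0r.
have key2 x : lambda x = 0 -> lie v x = 0 -> exists k, x = k *: v.
  move=> lx vx; exists (psi x / psi v).
  rewrite {2}of_coords scalerA divfK //; apply: key => // y.
  by rewrite vP ?lie_derived // kinv [lie x v]lieC vx oppr0 linear0l oppr0.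
have lsub x : lambda (x - lambda x *: b) = 0.
  by rewrite linearB /= dualZ lb mulr1 subrr.
have bC x : lie x b = 0 by rewrite lieC cb oppr0.
have Kb z : z \in K -> z = lambda z *: b.
  move=> zK; apply/subr0_eq.
  have cz : central (z - lambda z *: b).
    by move=> y; rewrite lieDl Kc // lieNl lieZl cb scaler0 subrr.
  have [|k zk] := key2 _ (lsub z); first by rewrite lieC cz oppr0.
  by apply: (central_derived gR) => //; rewrite zk rpredZ.
have HD x : lambda x = 0 -> x \in derived_algebra g.
  have [d dD [k kK ->]] := decK x; rewrite linearD /= (lD d dD) add0r => lk.
  by rewrite (Kb k kK) lk scale0r addr0.
exists b; split=> //.
have kb x : trace_form e b x = 0.
  rewrite /trace_form (_ : ad_mx e b = 0) ?mul0mx ?mxtrace0 //.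
  by apply/matrixP => i j; rewrite !mxE cb linear0.
have kvv : trace_form e v v != 0 by rewrite -vP.
rewrite (size_basis eB).
apply: (rank_one_dim eB (B := lee_form e lambda) (b := b) (v := v)) => //=.
- by move=> x y; rewrite /lee_form trace_formC mulrC.
- move=> x xB; have lx : lambda x = 0.
    by have := xB b; rewrite /lee_form trace_formC kb lb mulr1 add0r.
  apply: (trace_form_derived eB gR (HD x lx)) => y.
  by have := xB y; rewrite /lee_form lx mul0r addr0.
- move=> x y z; rewrite /lee_form !lie0 mul0r mulr0 !addr0.
  exact: trace_form_inv eB x y z.
- by rewrite /lee_form kb lb add0r mulr1 oner_neq0.
- by rewrite /lee_form (lD v vD) mulr0 addr0.
- by rewrite /lee_form kb (lD v vD) mulr0 addr0.
- move=> x vx; exists (lambda x).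
  have [|k xk] := key2 _ (lsub x).
    by rewrite lieDr lieNr lieZr bC scaler0 subr0.
  by exists k; rewrite -xk addrC subrK.
- by move=> cv; case/eqP: v0; apply: (central_derived gR).
Qed.

(** * Complex structures in dimension four *)

Section Quadruples.
Variables (F : fieldType) (V : vectType F) (x0 x1 x2 x3 : V).
Let X := [tuple x0; x1; x2; x3].

Lemma sum4 (W : zmodType) (f : 'I_4 -> W) :
  \sum_i f i = f 0 + f 1 + f 2 + f 3.
Proof.
rewrite !big_ord_recl big_ord0 addr0 !addrA.
by congr (_ + _ + _ + _); congr f; apply: val_inj.
Qed.

Lemma basis4 : \dim {:V} = 4%N ->
  (forall a b c d, a *: x0 + b *: x1 + c *: x2 + d *: x3 = 0 ->
    [/\ a = 0, b = 0, c = 0 & d = 0]) -> basis_of fullv X.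
Proof.
move=> dimV free4; rewrite basisEfree subvf dimV size_tuple leqnn !andbT.
apply/freeP => k; rewrite sum4 /= => /free4 [h0 h1 h2 h3].
by case=> [[|[|[|[|//]]]] i4]; [apply: etrans h0|apply: etrans h1
  |apply: etrans h2|apply: etrans h3]; congr k; apply: val_inj.
Qed.

Hypothesis XB : basis_of fullv X.

Lemma coord4 x : x = coord X 0 x *: x0 + coord X 1 x *: x1
                   + coord X 2 x *: x2 + coord X 3 x *: x3.
Proof. by rewrite {1}(coord_basis XB (memvf x)) sum4. Qed.

Lemma coord4E a b c d (x := a *: x0 + b *: x1 + c *: x2 + d *: x3) :
  [/\ coord X 0 x = a, coord X 1 x = b, coord X 2 x = c & coord X 3 x = d].
Proof.
pose k (i : 'I_4) := [:: a; b; c; d]`_i.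
have xE : x = \sum_(i < 4) k i *: X`_i by rewrite sum4.
by rewrite xE; split; apply: (coord_sum_free k _ (basis_free XB)).
Qed.

Lemma coord4_inj a b c d a' b' c' d' :
  a *: x0 + b *: x1 + c *: x2 + d *: x3 =
  a' *: x0 + b' *: x1 + c' *: x2 + d' *: x3 ->
  [/\ a = a', b = b', c = c' & d = d'].
Proof.
move=> e; have /= := coord4E a b c d; rewrite e.
by have /= [-> -> -> ->] := coord4E a' b' c' d'; case=> -> -> -> ->.
Qed.

End Quadruples.

(** The four-dimensional algebras [R e0 + h] with [h] three-dimensional and
    simple: [k = 1] is the compact case and [k = -1] the split one. *)
Definition simple_frame (F : fieldType) (g : lieAlgType F) (k : F)
    (e0 e1 e2 e3 : g) : Prop :=
  [/\ basis_of fullv [tuple e0; e1; e2; e3], central e0 &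
      [/\ lie e1 e2 = - e3, lie e3 e1 = - e2 & lie e2 e3 = - (k *: e1)]].

(** Integrability tested on the central vector [b] says that [lie y] commutes
    with [J], where [y = J b - p b]. Hence its image [L] is [J]-stable, while
    [J y] is not in the kernel of [lambda]; so [y] is not in [L], and [b], [y],
    [e2] and [e3 = - J e2] form a basis. On the plane of [e2] and [e3], [lie y]
    is [r + q J], and as a derivation it multiplies [lie e2 e3] by [2 r]. But
    values of [lie y] have no component along [y], while [lie e2 e3] has one,
    since otherwise all brackets, hence [y], would lie in that plane; so
    [r = 0]. *)
Lemma complex_structure_frame (R : rcfType) (g : lieAlgType R) (J : 'End(g))
    (lambda : 'Hom(g, R^o)) (b : g) :
  reductive g -> complex_structure J -> central b -> lambda b = 1 ->
  (forall x, (lambda x == 0) = (x \in derived_algebra g)) ->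
  \dim {:g} = 4%N ->
  exists e0 e1 e2 e3 k, exists p q : R,
    [/\ simple_frame k e0 e1 e2 e3, k = 1 \/ k = -1,
        [/\ lambda e0 = -1, lambda e1 = 0, lambda e2 = 0 & lambda e3 = 0],
        q != 0 &
        [/\ J e0 = p *: e0 + q *: e1, J e1 = - ((1 + p ^+ 2) / q) *: e0 - p *: e1,
            J e2 = - e3 & J e3 = e2]].
Proof.
move=> gR [JJ Jint] cb lb lD dim4.
have JZ a x : J (a *: x) = a *: J x by apply: linearZ.
have JD x z : J (x + z) = J x + J z by apply: linearD.
have bC x : lie x b = 0 by rewrite lieC cb oppr0.
have lie0 x y : lambda (lie x y) = 0 by apply/eqP; rewrite lD lie_derived.
pose p := lambda (J b).
have [y Jb ly] : exists2 y, J b = p *: b + y & lambda y = 0.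
  exists (J b - p *: b); first by rewrite addrC subrK.
  by rewrite linearB /= dualZ lb mulr1 subrr.
have Jy : J y = - (1 + p ^+ 2) *: b - p *: y.
  have := JJ b; rewrite Jb linearD linearZ /= Jb => h.
  have -> : J y = - b - p *: (p *: b + y) by rewrite -h addrAC subrr add0r.
  by rewrite scalerDr scalerA opprD addrA -expr2 scaleNr scalerDl scale1r opprD.
have pp : 1 + p ^+ 2 != 0 by rewrite gt_eqF // ltr_wpDr ?sqr_ge0.
have lJy : lambda (J y) != 0.
  by rewrite Jy linearB /= !dualZ lb ly mulr0 subr0 mulr1 oppr_eq0.
have yD : y \in derived_algebra g by rewrite -lD ly.
have liey x : lie (J b) x = lie y x by rewrite Jb lieDl lieZl cb scaler0 add0r.
have yJ x : lie y (J x) = J (lie y x).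
  have := Jint b x; rewrite !liey !cb linear0 !subr0.
  exact: subr0_eq.
pose L := limg (linfun (lie y)).
have memL x : lie y x \in L.
  by rewrite -[lie y x](lfunE (lie y)) memv_img ?memvf.
have LP x : x \in L -> exists z, x = lie y z.
  by case/memv_imgP => z _ ->; exists z; rewrite lfunE.
have lL x : x \in L -> lambda x = 0 by case/LP => z ->.
have JL x : x \in L -> J x \in L by case/LP => z ->; rewrite -yJ.
have yL : y \notin L by apply: contra lJy => /JL/lL ->.
have [x0 yx0] : exists x0, lie y x0 != 0.
  have /subvPn [x _ xk] : ~~ (fullv <= lker (linfun (lie y)))%VS.
    apply: contra yL => /subvP h; suff -> : y = 0 by rewrite mem0v.
    apply: (central_derived gR) => // z.
    by have := h z (memvf z); rewrite memv_ker lfunE => /eqP.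
  by exists x; move: xk; rewrite memv_ker lfunE.
have [e2 e2E e20] : exists2 e2, e2 = lie y x0 & e2 != 0 by exists (lie y x0).
have [e3 Je2 Je3] : exists2 e3, J e2 = - e3 & J e3 = e2.
  by exists (- J e2); rewrite ?opprK // linearN /= JJ opprK.
have e2L : e2 \in L by rewrite e2E.
have e3L : e3 \in L by rewrite -rpredN -Je2 JL.
have free4 a c d f : a *: b + c *: y + d *: e2 + f *: e3 = 0 ->
    [/\ a = 0, c = 0, d = 0 & f = 0].
  move=> h; have a0 : a = 0.
    have := congr1 lambda h; rewrite !linearD /= !dualZ lb ly (lL _ e2L) (lL _ e3L) linear0.
    by rewrite !mulr0 mulr1 !addr0.
  move: h; rewrite a0 scale0r add0r => h.
  have c0 : c = 0.
    apply/eqP; apply: contraNT yL => c0.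
    rewrite -[y](scalerK c0) rpredZ //.
    have -> : c *: y = - (d *: e2 + f *: e3).
      by apply/eqP; rewrite -addr_eq0 addrA h.
    by rewrite rpredN rpredD ?rpredZ.
  move: h; rewrite c0 scale0r add0r => h.
  have h' : d *: e3 - f *: e2 = 0.
    have := congr1 J h; rewrite JD !JZ linear0 Je2 Je3 scalerN => h1.
    by apply/eqP; rewrite -oppr_eq0 opprB addrC h1.
  have : (d ^+ 2 + f ^+ 2) *: e2 = 0.
    transitivity (d *: (d *: e2 + f *: e3) - f *: (d *: e3 - f *: e2)).
      rewrite scalerDr scalerBr !scalerA opprB addrACA -addrA.
      by rewrite [f * d]mulrC subrr addr0 -scalerDl !expr2.
    by rewrite h h' !scaler0 subrr.
  move/eqP; rewrite scaler_eq0 (negbTE e20) orbF paddr_eq0 ?sqr_ge0 //.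
  by rewrite !sqrf_eq0 => /andP [/eqP -> /eqP ->].
have XB := basis4 dim4 free4.
have ye0 x : lambda x = 0 -> exists c d f, x = c *: y + d *: e2 + f *: e3.
  have [a [c [d [f ->]]]] : exists a c d f,
      x = a *: b + c *: y + d *: e2 + f *: e3.
    by do 4 eexists; apply: (coord4 XB).
  rewrite !linearD /= !dualZ lb ly (lL _ e2L) (lL _ e3L) !mulr0 !addr0 mulr1.
  by move=> ->; exists c, d, f; rewrite scale0r add0r.
have [r [q ye2]] : exists r q, lie y e2 = r *: e2 - q *: e3.
  have [|c [d [f h]]] := ye0 (lie y e2); first by apply: lie0.
  suff c0 : c = 0 by exists d, (- f); rewrite h c0 scale0r add0r scaleNr opprK.
  apply/eqP; apply: contraNT yL => c0; rewrite -[y](scalerK c0) rpredZ //.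
  have -> : c *: y = lie y e2 - (d *: e2 + f *: e3) by rewrite h -(addrA (c *: y)) addrK.
  by rewrite rpredB // rpredD ?rpredZ.
have ye3 : lie y e3 = r *: e3 + q *: e2.
  have e3E : e3 = - J e2 by rewrite Je2 opprK.
  rewrite {1}e3E lieNr yJ ye2 linearB /= !JZ Je2 Je3 scalerN.
  by rewrite opprD !opprK.
have [k [i2 [i3 e23]]] : exists k i2 i3, lie e2 e3 = k *: y + i2 *: e2 + i3 *: e3.
  exact/ye0/lie0.
have yin : y \notin <<[:: e2; e3]>>%VS.
  apply: contra yL; apply: subvP; apply/span_subvP => u.
  by rewrite !inE => /orP [] /eqP ->.
have k0 : k != 0.
  apply: contraNneq yin => k0; apply: (subvP (derived_sub _)) yD => u w.
  have := coord4 XB u; have := coord4 XB w.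
  move: (coord _ 0 u) (coord _ 1 u) (coord _ 2 u) (coord _ 3 u) => u0 u1 u2 u3.
  move: (coord _ 0 w) (coord _ 1 w) (coord _ 2 w) (coord _ 3 w) => w0 w1 w2 w3.
  have i2s : e2 \in <<[:: e2; e3]>>%VS by rewrite memv_span ?mem_head.
  have i3s : e3 \in <<[:: e2; e3]>>%VS by rewrite memv_span // !inE eqxx orbT.
  have s1 : lie y e2 \in <<[:: e2; e3]>>%VS.
    by rewrite ye2 rpredB ?rpredZ.
  have s2 : lie y e3 \in <<[:: e2; e3]>>%VS.
    by rewrite ye3 rpredD ?rpredZ.
  have s3 : lie e2 e3 \in <<[:: e2; e3]>>%VS.
    by rewrite e23 k0 scale0r add0r rpredD ?rpredZ.
  have sN x1 x2 : lie x1 x2 \in <<[:: e2; e3]>>%VS -> lie x2 x1 \in <<[:: e2; e3]>>%VS.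
    by rewrite [lie x1 x2]lieC rpredN.
  move=> -> ->; rewrite !(lieDl, lieDr, lieZl, lieZr) !cb !bC !liexx !scaler0 !add0r !addr0.
  by rewrite !(rpredD, rpredZ, s1, s2, s3) ?(sN _ _ s1) ?(sN _ _ s2) ?(sN _ _ s3).
have yder : lie y (lie e2 e3) = (2 * r) *: lie e2 e3.
  rewrite lie_der ye2 ye3 lieDl lieDr lieNl !lieZl !lieZr !liexx !scaler0.
  by rewrite oppr0 !addr0 -scalerDl; congr (_ *: _); ring.
have yl : lie y (lie e2 e3) = 0 *: b + 0 *: y
    + (i2 * r + i3 * q) *: e2 + (i3 * r - i2 * q) *: e3.
  rewrite e23 lieDr (lieDr y) !lieZr liexx ye2 ye3 scaler0 add0r !scale0r !add0r.
  rewrite scalerDl scalerBl scalerBr scalerDr !scalerA [i3 * r *: _ + _]addrC.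
  by rewrite [in LHS](addrC ((i3 * r) *: e3)) addrACA.
have yr : (2 * r) *: lie e2 e3 = 0 *: b + (2 * r * k) *: y
    + (2 * r * i2) *: e2 + (2 * r * i3) *: e3.
  by rewrite e23 !scalerDr !scalerA scale0r add0r.
have [_ rk h2 h3] := coord4_inj XB (etrans (esym yl) (etrans yder yr)).
have r0 : r = 0.
  by move/esym/eqP: rk; rewrite !mulf_eq0 pnatr_eq0 (negbTE k0) /= orbF => /eqP.
rewrite r0 !mulr0 !mul0r ?add0r ?sub0r in h2 h3.
have q0 : q != 0.
  apply: contraNneq e20 => q0; rewrite e2E [x0](coord4 XB).
  rewrite !lieDr !lieZr bC liexx ye2 ye3 r0 q0 !scale0r subrr addr0.
  by rewrite !scaler0 !addr0.
have i30 : i3 = 0 by move/eqP: h2; rewrite mulf_eq0 (negbTE q0) orbF => /eqP.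
have i20 : i2 = 0.
  by move/eqP: h3; rewrite oppr_eq0 mulf_eq0 (negbTE q0) orbF => /eqP.
move: ye2 ye3 e23; rewrite r0 i20 i30 !scale0r !add0r !addr0 => ye2 ye3 e23.
(* the factor [t] below normalizes the structure constant to a sign *)
have kq0 : `|k * q| != 0 by rewrite normr_eq0 mulf_neq0.
pose t := (Num.sqrt `|k * q|)^-1.
have tt : t ^+ 2 * `|k * q| = 1.
  by rewrite exprVn sqr_sqrtr ?normr_ge0 // mulVf.
have t0 : t != 0.
  by apply: contraTneq isT => t0; move/eqP: tt; rewrite t0 expr0n mul0r eq_sym oner_eq0.
exists (- b), (q^-1 *: y), (t *: e2), (t *: e3), (- (t ^+ 2 * (k * q))), p, (- q).
split.
- split.
  + apply: basis4 => // a c d f; rewrite scalerN -scaleNr !scalerA => /free4.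
    case=> /eqP + /eqP + /eqP + /eqP; rewrite oppr_eq0 !mulf_eq0 invr_eq0.
    by rewrite (negbTE q0) (negbTE t0) !orbF => /eqP -> /eqP -> /eqP -> /eqP ->.
  + by move=> x; rewrite lieNl cb oppr0.
  + rewrite !lieZl !lieZr ye2 [lie e3 y]lieC ye3 e23 !scalerN !scalerA.
    split; [| |rewrite mulNr scaleNr opprK]; rewrite -?scaleNr;
      by congr (_ *: _); field.
- have : k * q != 0 by rewrite -normr_eq0.
  move: tt; case: (ltrgt0P (k * q)) => // _; rewrite ?mulrN => -> _.
    by right.
  by left.
- by rewrite linearN /= !dualZ lb ly (lL _ e2L) (lL _ e3L) !mulr0.
- by rewrite oppr_eq0.
- rewrite linearN /= !JZ Jb Jy Je2 Je3 scalerN; split=> //.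
  + rewrite opprD; congr (_ + _).
    by rewrite scaleNr scalerA divff // scale1r.
  + rewrite scalerBr !scalerA [p * _]mulrC; congr (_ - _).
    by rewrite ?scalerN -scaleNr; congr (_ *: _); field.
  + by rewrite scalerN.
Qed.

(** * Four-dimensional frames *)

Lemma dual_basisE (F : fieldType) (g : lieAlgType F) n (e : n.-tuple g) i x :
  dual_basis e i x = coord e i x.
Proof. by rewrite lfunE. Qed.

Section QuadrupleArithmetic.
Variables (F : fieldType) (V : lmodType F) (x0 x1 x2 x3 : V).

Definition comb4 (a b c d : F) := a *: x0 + b *: x1 + c *: x2 + d *: x3.

Lemma comb4D a b c d a' b' c' d' : comb4 a b c d + comb4 a' b' c' d' =
  comb4 (a + a') (b + b') (c + c') (d + d').
Proof.
rewrite /comb4 !scalerDl (addrACA (a *: x0 + _ + _)) (addrACA (a *: x0 + _)).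
by rewrite (addrACA (a *: x0)).
Qed.

Lemma comb4Z l a b c d : l *: comb4 a b c d =
  comb4 (l * a) (l * b) (l * c) (l * d).
Proof. by rewrite /comb4 !scalerDr !scalerA. Qed.

End QuadrupleArithmetic.

Section SimpleFrame.
Variables (F : fieldType) (g : lieAlgType F) (k : F) (e0 e1 e2 e3 : g).
Hypothesis eF : simple_frame k e0 e1 e2 e3.
Let X := [tuple e0; e1; e2; e3].
Let comb := comb4 e0 e1 e2 e3.

Lemma simple_frame_basis : basis_of fullv X. Proof. by case: eF. Qed.

Lemma simple_frame_comb x :
  x = comb (coord X 0 x) (coord X 1 x) (coord X 2 x) (coord X 3 x).
Proof. exact/coord4/simple_frame_basis. Qed.

Lemma simple_frame_lie a0 a1 a2 a3 c0 c1 c2 c3 :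
  lie (comb a0 a1 a2 a3) (comb c0 c1 c2 c3) =
  comb 0 (k * (a3 * c2 - a2 * c3)) (a1 * c3 - a3 * c1) (a2 * c1 - a1 * c2).
Proof.
case: eF => _ ce0 [l12 l31 l23].
have bC x : lie x e0 = 0 by rewrite lieC ce0 oppr0.
have l1 : lie e1 (comb c0 c1 c2 c3) = comb 0 0 c3 (- c2).
  rewrite /comb /comb4 !lieDr !lieZr bC liexx l12 [lie e1 e3]lieC l31 opprK.
  by rewrite !scaler0 !scale0r !add0r scalerN scaleNr addrC.
have l2 : lie e2 (comb c0 c1 c2 c3) = comb 0 (- (k * c3)) 0 c1.
  rewrite /comb /comb4 !lieDr !lieZr bC liexx l23 [lie e2 e1]lieC l12 opprK.
  rewrite !scaler0 !scale0r !add0r !addr0 scalerN scalerA mulrC scaleNr.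
  by rewrite addrC.
have l3 : lie e3 (comb c0 c1 c2 c3) = comb 0 (k * c2) (- c1) 0.
  rewrite /comb /comb4 !lieDr !lieZr bC liexx l31 [lie e3 e2]lieC l23 opprK.
  rewrite !scaler0 !scale0r !add0r !addr0 scalerN scalerA mulrC scaleNr.
  by rewrite addrC.
rewrite [in LHS]/comb /comb4 !lieDl !lieZl ce0 scaler0 add0r l1 l2 l3.
by rewrite !comb4Z !comb4D; congr comb4; ring.
Qed.

Lemma alternating_comb4 (w : {biscalar g}) :
  (forall x, w x x = 0) -> forall a0 a1 a2 a3 c0 c1 c2 c3,
  w (comb a0 a1 a2 a3) (comb c0 c1 c2 c3) =
  (a0 * c1 - a1 * c0) * w e0 e1 + (a0 * c2 - a2 * c0) * w e0 e2
  + (a0 * c3 - a3 * c0) * w e0 e3 + (a1 * c2 - a2 * c1) * w e1 e2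
  + (a1 * c3 - a3 * c1) * w e1 e3 + (a2 * c3 - a3 * c2) * w e2 e3.
Proof.
move=> w0 a0 a1 a2 a3 c0 c1 c2 c3; have wC := alternatingC w0.
rewrite /comb /comb4 !linearDl !linearDr !linearZl_LR !linearZr_LR /= !w0.
rewrite (wC e1 e0) (wC e2 e0) (wC e3 e0) (wC e2 e1) (wC e3 e1) (wC e3 e2).
ring.
Qed.

End SimpleFrame.

Lemma simple_frame_isomorphic (R : fieldType) (g h : lieAlgType R) (k : R)
    (e0 e1 e2 e3 : g) (f0 f1 f2 f3 : h) :
  simple_frame k e0 e1 e2 e3 -> simple_frame k f0 f1 f2 f3 ->
  lie_isomorphic g h.
Proof.
move=> eF fF; pose X := [tuple e0; e1; e2; e3]; pose Y := [tuple f0; f1; f2; f3].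
have XB := simple_frame_basis eF; have YB := simple_frame_basis fF.
pose F x := comb4 f0 f1 f2 f3 (coord X 0 x) (coord X 1 x) (coord X 2 x) (coord X 3 x).
pose G x := comb4 e0 e1 e2 e3 (coord Y 0 x) (coord Y 1 x) (coord Y 2 x) (coord Y 3 x).
have FE a b c d : F (comb4 e0 e1 e2 e3 a b c d) = comb4 f0 f1 f2 f3 a b c d.
  by rewrite /F; have /= [-> -> -> ->] := coord4E XB a b c d.
have GE a b c d : G (comb4 f0 f1 f2 f3 a b c d) = comb4 e0 e1 e2 e3 a b c d.
  by rewrite /G; have /= [-> -> -> ->] := coord4E YB a b c d.
have Flin : linear F.
  by move=> a x y; rewrite /F !linearP /= comb4Z comb4D.
pose Fl : {linear g -> h} :=
  HB.pack F (GRing.isLinear.Build R g h _ F Flin).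
exists (linfun Fl).
  exists G => x; rewrite ?lfunE /=.
    by rewrite [x](simple_frame_comb eF) FE GE.
  by rewrite [x](simple_frame_comb fF) GE FE.
move=> x y; rewrite !lfunE /= [x](simple_frame_comb eF) [y](simple_frame_comb eF).
by rewrite (simple_frame_lie eF) !FE (simple_frame_lie fF).
Qed.

(** Here [lie x] is skew for a definite form on the span of [e1], [e2], [e3],
    so it has no nonzero real eigenvalue. Together with [split_frame_eigen] this
    distinguishes the two algebras. *)
Lemma compact_frame_eigen (R : realFieldType) (g : lieAlgType R)
    (e0 e1 e2 e3 : g) : simple_frame 1 e0 e1 e2 e3 ->
  forall x y : g, lie x y = 2 *: y -> y = 0.
Proof.
move=> eF x y; pose X := [tuple e0; e1; e2; e3].
have := simple_frame_comb eF y; have := simple_frame_comb eF x.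
move: (coord X 0 x) (coord X 1 x) (coord X 2 x) (coord X 3 x) => a0 a1 a2 a3 ->.
move: (coord X 0 y) (coord X 1 y) (coord X 2 y) (coord X 3 y) => c0 c1 c2 c3 ->.
rewrite (simple_frame_lie eF) comb4Z => /(coord4_inj (simple_frame_basis eF)).
rewrite !mul1r => -[h0 h1 h2 h3].
have s0 : c1 ^+ 2 + c2 ^+ 2 + c3 ^+ 2 = 0.
  have -> : c1 ^+ 2 + c2 ^+ 2 + c3 ^+ 2 =
    2^-1 * (c1 * (2 * c1) + c2 * (2 * c2) + c3 * (2 * c3)) by field.
  by rewrite -h1 -h2 -h3; ring.
move/eqP: s0; rewrite !paddr_eq0 ?addr_ge0 ?sqr_ge0 // !sqrf_eq0.
move=> /andP [/andP [/eqP -> /eqP ->] /eqP ->].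
have -> : c0 = 0 by lra.
by rewrite /comb4 !scale0r !addr0.
Qed.

(** Twice [e2] is the semisimple element of a standard triple. *)
Lemma split_frame_eigen (R : realFieldType) (g : lieAlgType R) (e0 e1 e2 e3 : g) :
  simple_frame (-1) e0 e1 e2 e3 -> ~ (forall x y : g, lie x y = 2 *: y -> y = 0).
Proof.
move=> eF h; have := h (comb4 e0 e1 e2 e3 0 0 2 0) (comb4 e0 e1 e2 e3 0 (-1) 0 (-1)).
rewrite (simple_frame_lie eF) comb4Z => h'.
have {}h' : comb4 e0 e1 e2 e3 0 (-1) 0 (-1) = comb4 e0 e1 e2 e3 0 0 0 0.
  rewrite h'; first by rewrite /comb4 !scale0r !addr0.
  by congr comb4; ring.
have [_ /eqP e _ _] := coord4_inj (simple_frame_basis eF) h'.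
by move: e; rewrite oppr_eq0 oner_eq0.
Qed.

Lemma lie_isomorphic_eigen (R : fieldType) (g h : lieAlgType R) :
  lie_isomorphic g h ->
  (forall x y : h, lie x y = 2 *: y -> y = 0) <->
  (forall x y : g, lie x y = 2 *: y -> y = 0).
Proof.
move=> [f [f' fK f'K] fL]; split=> nE x y xy.
  by apply: (can_inj fK); rewrite linear0; apply: (nE (f x)); rewrite -fL xy linearZ.
suff y0 : f' y = 0 by rewrite -(f'K y) y0 linear0.
apply: (nE (f' x)); apply: (can_inj fK).
by rewrite fL !f'K xy linearZ /= f'K.
Qed.

(** * Frames of the two models *)

Lemma sum2 (W : zmodType) (f : 'I_2 -> W) : \sum_i f i = f 0 + f 1.
Proof.
by rewrite !big_ord_recl big_ord0 addr0; congr (_ + f _); apply: val_inj.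
Qed.

Lemma ord2P (P : 'I_2 -> Prop) : P 0 -> P 1 -> forall i, P i.
Proof.
move=> P0 P1 [[|[|//]] i2].
  by rewrite (_ : Ordinal i2 = 0) //; apply: val_inj.
by rewrite (_ : Ordinal i2 = 1) //; apply: val_inj.
Qed.

Lemma ord4P (P : 'I_4 -> Prop) : P 0 -> P 1 -> P 2 -> P 3 -> forall i, P i.
Proof.
move=> P0 P1 P2 P3 [[|[|[|[|//]]]] i4].
- by rewrite (_ : Ordinal i4 = 0) //; apply: val_inj.
- by rewrite (_ : Ordinal i4 = 1) //; apply: val_inj.
- by rewrite (_ : Ordinal i4 = 2) //; apply: val_inj.
- by rewrite (_ : Ordinal i4 = 3) //; apply: val_inj.
Qed.

Section UnitaryModel.
Variable R : rcfType.

Definition u2_elt (a b c d : R) : u2 R :=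
  U2 (u2_matrix_skew (\row_j [:: a; b; c; d]`_j : 'rV[R]_4)).

Lemma u2_elt_coords a b c d :
  u2_coords (u2_elt a b c d) = \row_j [:: a; b; c; d]`_j.
Proof. by apply/rowP; apply: ord4P; rewrite !mxE /= ?mxE. Qed.

Lemma u2_eltP (A : u2 R) : exists a b c d, A = u2_elt a b c d.
Proof.
exists (u2_coords A 0 0), (u2_coords A 0 1), (u2_coords A 0 2), (u2_coords A 0 3).
apply: (bij_inj (u2_coords_bij R)); rewrite u2_elt_coords.
by apply/rowP; apply: ord4P; rewrite [RHS]mxE.
Qed.

Lemma u2_elt_inj a b c d a' b' c' d' : u2_elt a b c d = u2_elt a' b' c' d' ->
  [/\ a = a', b = b', c = c' & d = d'].
Proof.
move=> /(congr1 (@u2_coords R)); rewrite !u2_elt_coords => /rowP h.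
by have := h 0; have := h 1; have := h 2; have := h 3; rewrite !mxE.
Qed.

Lemma u2_eltD a b c d a' b' c' d' : u2_elt a b c d + u2_elt a' b' c' d' =
  u2_elt (a + a') (b + b') (c + c') (d + d').
Proof.
apply: (bij_inj (u2_coords_bij R)).
rewrite -[u2_elt a b c d]scale1r u2_coords_linear !u2_elt_coords scale1r.
by apply/rowP; apply: ord4P; rewrite !mxE.
Qed.

Lemma u2_eltZ l a b c d :
  l *: u2_elt a b c d = u2_elt (l * a) (l * b) (l * c) (l * d).
Proof.
apply: (bij_inj (u2_coords_bij R)).
have c0 : u2_coords (0 : u2 R) = 0.
  have := u2_coords_linear 1 (0 : u2 R) 0; rewrite !scale1r addr0 => h.
  by apply: (addrI (u2_coords (0 : u2 R))); rewrite addr0 -h.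
rewrite -[l *: _]addr0 u2_coords_linear !u2_elt_coords c0 addr0.
by apply/rowP; apply: ord4P; rewrite !mxE.
Qed.

Lemma u2_elt_lie a b c d a' b' c' d' :
  lie (u2_elt a b c d) (u2_elt a' b' c' d') =
  u2_elt (2 * (c * d' - d * c')) (- (2 * (c * d' - d * c')))
    ((a' - b') * d - (a - b) * d') ((a - b) * c' - (a' - b') * c).
Proof.
apply: val_inj; apply/matrixP; apply: ord2P; apply: ord2P;
  rewrite /= /commutator !mxE !sum2 !mxE /=; apply/eqP;
  rewrite eq_complex /=; apply/andP; split; apply/eqP; ring.
Qed.

(** The identity and half the Pauli matrices, all multiplied by [i]. *)
Lemma u2_simple_frame :
  exists e0 e1 e2 e3 : u2 R, simple_frame 1 e0 e1 e2 e3.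
Proof.
exists (u2_elt 1 1 0 0), (u2_elt 0 0 0 2^-1), (u2_elt 0 0 2^-1 0),
  (u2_elt 2^-1 (- 2^-1) 0 0).
split.
- apply: basis4; first by rewrite dimvf.
  move=> a b c d; rewrite !u2_eltZ !u2_eltD.
  have <- : u2_elt 0 0 0 0 = 0.
    by rewrite -[RHS](scale0r (u2_elt 1 1 1 1)) u2_eltZ !mul0r.
  by move/u2_elt_inj => [h0 h1 h2 h3]; split; lra.
- move=> A; have [a [b [c [d ->]]]] := u2_eltP A.
  rewrite u2_elt_lie -[RHS](scale0r (u2_elt 1 1 1 1)) u2_eltZ !mul0r.
  by congr u2_elt; ring.
- rewrite !u2_elt_lie -!scaleN1r !u2_eltZ.
  by rewrite ?u2_eltZ; split; congr u2_elt; field.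
Qed.

End UnitaryModel.

Lemma gl2_simple_frame (R : realFieldType) :
  exists e0 e1 e2 e3 : 'M[R]_2, simple_frame (-1) e0 e1 e2 e3.
Proof.
pose el a b c d : 'M[R]_2 := \matrix_(i, j)
  if i == 0 then (if j == 0 then a else b) else (if j == 0 then c else d).
have elP (A B : 'M[R]_2) :
    A 0 0 = B 0 0 -> A 0 1 = B 0 1 -> A 1 0 = B 1 0 -> A 1 1 = B 1 1 -> A = B.
  move=> h00 h01 h10 h11; apply/matrixP => i j.
  have ord2 (l : 'I_2) : l = 0 \/ l = 1.
    by case: l => [[|[|//]] ?]; [left|right]; apply: val_inj.
  by have [->|->] := ord2 i; have [->|->] := ord2 j.
exists (el 1 0 0 1), (el 0 (- 2^-1) 2^-1 0), (el 2^-1 0 0 (- 2^-1)),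
  (el 0 (- 2^-1) (- 2^-1) 0).
split.
- apply: basis4; first by rewrite dimvf.
  move=> a b c d /matrixP h.
  have := h 0 0; have := h 0 1; have := h 1 0; have := h 1 1.
  by rewrite !mxE /= => h1 h2 h3 h4; split; lra.
- by move=> A; apply: elP; rewrite /lie /= /commutator !mxE !sum2 !mxE /=; ring.
- by split; apply: elP; rewrite /lie /= /commutator !mxE !sum2 !mxE /=; field.
Qed.

(** * Normal forms *)

Section NormalForms.
Variables (R : realType) (g : lieAlgType R) (omega : {biscalar g}) (J : 'End(g))
  (lambda : 'Hom(g, R^o)) (e0 e1 e2 e3 : g) (k p q : R).
Hypothesis wJ : lcpk omega J lambda.
Hypothesis eF : simple_frame k e0 e1 e2 e3.
Hypothesis lE :
  [/\ lambda e0 = -1, lambda e1 = 0, lambda e2 = 0 & lambda e3 = 0].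
Hypothesis q0 : q != 0.
Hypothesis JE :
  [/\ J e0 = p *: e0 + q *: e1, J e1 = - ((1 + p ^+ 2) / q) *: e0 - p *: e1,
      J e2 = - e3 & J e3 = e2].

Let w0 x : omega x x = 0. Proof. by case: wJ => -[]. Qed.

Let ce0 : central e0. Proof. by case: eF. Qed.

Lemma frame_primitive x y : omega x y =
  - omega e0 (lie x y) - lambda x * omega e0 y + lambda y * omega e0 x.
Proof.
have [w _ _] := wJ; rewrite (lcs_primitive w (b := - e0)) /=; last first.
- by case: lE => l0 _ _ _; rewrite linearN /= l0 opprK.
- by move=> z; rewrite lieNl ce0 oppr0.
by rewrite !linearNl /=; ring.
Qed.

Lemma frame_form_values : [/\ omega e1 e2 = omega e0 e3,
  omega e1 e3 = - omega e0 e2 & omega e2 e3 = k * omega e0 e1].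
Proof.
case: eF lE => _ _ [l12 l31 l23] [_ l1 l2 l3].
rewrite !(frame_primitive e1) (frame_primitive e2) l12 [lie e1 e3]lieC l31 l23.
rewrite l1 l2 l3 !linearNr linearZr_LR /=; split; ring.
Qed.

(** [omega] is non-degenerate and [e0] is not zero. *)
Lemma frame_primitive_neq0 : ~ (forall y, omega e0 y = 0).
Proof.
move=> h; have [[_ nd _ _] _ _] := wJ; case: lE => l0 _ _ _.
by move: l0; rewrite (nd e0 h) linear0 => /esym/eqP; rewrite oppr_eq0 oner_eq0.
Qed.

(** Invariance of the form under [J], tested on [e0] against the plane
    [e2, e3], is a homogeneous linear system of determinant
    [p ^+ 2 + (q - 1) ^+ 2]. *)
Lemma frame_dichotomy :
  (omega e0 e2 = 0 /\ omega e0 e3 = 0) \/ (p = 0 /\ q = 1).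
Proof.
have [_ _ sk] := wJ; have [w12 w13 _] := frame_form_values.
case: JE => J0 _ J2 J3.
have := sk e0 e2; have := sk e0 e3.
rewrite J0 J2 J3 !linearDl !linearZl_LR !linearNr /= w12 w13 => s3 s2.
have [d0|d0] := eqVneq (p ^+ 2 + (q - 1) ^+ 2) 0.
  right; move/eqP: d0; rewrite paddr_eq0 ?sqr_ge0 // !sqrf_eq0 subr_eq0.
  by case/andP => /eqP -> /eqP ->.
left; split; apply: (mulfI d0); rewrite mulr0.
  transitivity (p * (p * omega e0 e2 + q * omega e0 e3 - omega e0 e3)
    - (q - 1) * (p * omega e0 e3 + q * - omega e0 e2 + omega e0 e2)).
    ring.
  by rewrite s2 s3; ring.
transitivity (p * (p * omega e0 e3 + q * - omega e0 e2 + omega e0 e2)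
  + (q - 1) * (p * omega e0 e2 + q * omega e0 e3 - omega e0 e3)).
  ring.
by rewrite s2 s3; ring.
Qed.

Lemma lambda_dual (f1 f2 f3 : g) : basis_of fullv [tuple e0; f1; f2; f3] ->
  lambda f1 = 0 -> lambda f2 = 0 -> lambda f3 = 0 ->
  lambda = - dual_basis [tuple e0; f1; f2; f3] 0.
Proof.
move=> fB l1 l2 l3; apply/lfunP => x; rewrite opp_lfunE dual_basisE.
rewrite {1}(coord4 fB x) !linearD /= !dualZ l1 l2 l3 !mulr0 !addr0.
by case: lE => -> _ _ _; rewrite mulrN1.
Qed.

Lemma frame_primitive_form (phi E0 : 'Hom(g, R^o)) : lambda = - E0 ->
  (forall x, phi x = omega e0 x) ->
  forall x y, omega x y = wedge11 E0 phi x y + d1 phi x y.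
Proof.
move=> lE0 phiE x y; rewrite /wedge11 /d1 !phiE frame_primitive lE0 !opp_lfunE.
ring.
Qed.

Lemma u2_frame_normal_form : k = 1 -> u2_normal_form omega J lambda.
Proof.
move=> k1; have XB := simple_frame_basis eF; have [_ _ br] := eF.
have [w12 w13 w23] := frame_form_values.
case: (lE) => l0 l1 l2 l3; have lD := lambda_dual XB l1 l2 l3.
exists e0, e1, e2, e3; split=> //.
  by case: br => -> -> ->; rewrite k1 scale1r.
exists p, q; split=> //.
have [[w2 w3]|[p0 q1]] := frame_dichotomy.
  left; exists (omega e0 e1).
    apply/eqP => w1; apply: frame_primitive_neq0 => y.
    rewrite (simple_frame_comb eF y) /comb4 !linearDr !linearZr_LR /= w0.
    by rewrite w1 w2 w3 !mulr0 !addr0.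
  move=> x y; rewrite /wedge11 !dual_basisE.
  rewrite {1}(simple_frame_comb eF x) {1}(simple_frame_comb eF y).
  rewrite (alternating_comb4 e0 e1 e2 e3 w0) w12 w13 w23 w2 w3 k1.
  ring.
right; split=> //; set X := [tuple e0; e1; e2; e3] in lD *.
pose phi := omega e0 e1 *: dual_basis X 1 + omega e0 e2 *: dual_basis X 2
  + omega e0 e3 *: dual_basis X 3.
have phiE x : phi x = omega e0 x.
  rewrite {2}(simple_frame_comb eF x) /comb4 !linearDr !linearZr_LR /= w0.
  rewrite !add_lfunE !scale_lfunE !dual_basisE /=.
  by rewrite mulr0 add0r; congr (_ + _ + _); apply: mulrC.
exists phi; split.
- apply/eqP => phi0; apply: frame_primitive_neq0 => y.
  by rewrite -phiE phi0 lfunE.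
- by rewrite !rpredD ?rpredZ ?memv_span ?inE ?eqxx ?orbT.
- exact: frame_primitive_form.
Qed.

(** The standard triple is [h = 2 e2], [ep = - e1 - e3], [em = e1 - e3], and
    the parameter has real part [q / (1 + p ^+ 2)] and imaginary part [p] times
    that. If the discriminant of the primitive vanished, the vector dual to the
    primitive in the trace form would be isotropic and lie in the kernel of
    [omega]. *)
Lemma gl2_frame_normal_form : k = -1 -> gl2_normal_form omega J lambda.
Proof.
move=> kN; have XB := simple_frame_basis eF; have [_ _ [l12 l31 l23]] := eF.
have [w12 w13 w23] := frame_form_values; have wC := alternatingC w0.
case: (lE) => l0 l1 l2 l3.
have two0 : (2 : R) != 0 by rewrite pnatr_eq0.
pose h := 2 *: e2; pose ep := - e1 - e3; pose em := e1 - e3.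
have combE a b c d : a *: e0 + b *: h + c *: ep + d *: em =
    comb4 e0 e1 e2 e3 a (d - c) (2 * b) (- c - d).
  have <- : comb4 e0 e1 e2 e3 a 0 0 0 + comb4 e0 e1 e2 e3 0 0 (2 * b) 0
    + comb4 e0 e1 e2 e3 0 (- c) 0 (- c) + comb4 e0 e1 e2 e3 0 d 0 (- d)
    = comb4 e0 e1 e2 e3 a (d - c) (2 * b) (- c - d).
    by rewrite !comb4D; congr comb4; ring.
  congr (_ + _ + _ + _); rewrite /comb4 !scale0r ?addr0 ?add0r //.
  - by rewrite /h scalerA mulrC.
  - by rewrite /ep scalerDr !scalerN !scaleNr.
  - by rewrite /em scalerDr !scalerN !scaleNr.
have YB : basis_of fullv [tuple e0; h; ep; em].
  apply: basis4; first by rewrite (size_basis XB).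
  move=> a b c d; rewrite combE.
  have <- : comb4 e0 e1 e2 e3 0 0 0 0 = 0 by rewrite /comb4 !scale0r !addr0.
  by move=> /(coord4_inj XB) [h0 h1 h2 h3]; split; lra.
have lD : lambda = - dual_basis [tuple e0; h; ep; em] 0.
  apply: lambda_dual YB _ _ _; rewrite /h /ep /em ?linearB ?linearN /=.
  - by rewrite dualZ l2 mulr0.
  - by rewrite l1 l3 subr0 oppr0.
  - by rewrite l1 l3 subr0.
have e0E : e0 = comb4 e0 e1 e2 e3 1 0 0 0.
  by rewrite /comb4 !scale0r scale1r !addr0.
have hE : h = comb4 e0 e1 e2 e3 0 0 2 0.
  by have := combE 0 1 0 0; rewrite !scale0r scale1r addr0 add0r addr0 => ->;
    congr comb4; ring.
have epE : ep = comb4 e0 e1 e2 e3 0 (-1) 0 (-1).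
  by have := combE 0 0 1 0; rewrite !scale0r scale1r addr0 !add0r => ->;
    congr comb4; ring.
have emE : em = comb4 e0 e1 e2 e3 0 1 0 (-1).
  by have := combE 0 0 0 1; rewrite !scale0r scale1r !add0r => ->;
    congr comb4; ring.
have brE : [/\ lie h ep = 2 *: ep, lie h em = - (2 *: em) & lie ep em = h].
  by rewrite -scaleN1r hE epE emE !(simple_frame_lie eF) !comb4Z kN;
    split; congr comb4; ring.
have Jcomb a0 a1 a2 a3 : J (comb4 e0 e1 e2 e3 a0 a1 a2 a3) = comb4 e0 e1 e2 e3
    (a0 * p - a1 * ((1 + p ^+ 2) / q)) (a0 * q - a1 * p) a3 (- a2).
  case: JE => J0 J1 J2 J3.
  have JZ a x : J (a *: x) = a *: J x by apply: linearZ.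
  rewrite {1}/comb4 !linearD /= !JZ.
  have -> : J e0 = comb4 e0 e1 e2 e3 p q 0 0.
    by rewrite J0 /comb4 !scale0r !addr0.
  have -> : J e1 = comb4 e0 e1 e2 e3 (- ((1 + p ^+ 2) / q)) (- p) 0 0.
    by rewrite J1 /comb4 !scale0r !addr0 !scaleNr.
  have -> : J e2 = comb4 e0 e1 e2 e3 0 0 0 (-1).
    by rewrite J2 /comb4 !scale0r !add0r scaleN1r.
  have -> : J e3 = comb4 e0 e1 e2 e3 0 0 1 0.
    by rewrite J3 /comb4 !scale0r !add0r scale1r addr0.
  by rewrite !comb4Z !comb4D; congr comb4; ring.
have ahE : omega e0 h = 2 * omega e0 e2 by rewrite linearZr_LR.
have apE : omega e0 ep = - omega e0 e1 - omega e0 e3.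
  by rewrite linearBr linearNr.
have amE : omega e0 em = omega e0 e1 - omega e0 e3 by rewrite linearBr.
clearbody h ep em.
exists e0, h, ep, em; split=> //.
pose mu1 := q / (1 + p ^+ 2); pose mu2 := p * mu1.
have pp : 1 + p ^+ 2 != 0 by rewrite gt_eqF // ltr_wpDr ?sqr_ge0.
have mu10 : mu1 != 0 by rewrite mulf_neq0 ?invr_eq0.
have aux a t s : a *: e0 - t *: (ep - em) - s *: h =
    comb4 e0 e1 e2 e3 a (2 * t) (- (2 * s)) 0.
  transitivity (a *: e0 + (- s) *: h + (- t) *: ep + t *: em).
    by rewrite scalerBr opprB !scaleNr addrAC [t *: em - _]addrC addrA.
  by rewrite combE; congr comb4; ring.
exists (Complex mu1 mu2) => /=; split=> //.
  split.
  - have := aux (mu2 / mu1) ((mu1 ^+ 2 + mu2 ^+ 2) / (2 * mu1)) 0.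
    rewrite scale0r subr0 => ->; rewrite {1}e0E Jcomb.
    by congr comb4; rewrite /mu2 /mu1; field; rewrite ?q0 ?pp.
  - by rewrite hE epE emE Jcomb comb4D; congr comb4; ring.
  - rewrite aux epE Jcomb.
    by congr comb4; rewrite /mu2 /mu1; field; rewrite ?q0 ?pp.
  - rewrite -scaleNr -[X in _ + X - _]opprK -[- (_ *: (ep - em))]scaleNr aux.
    rewrite emE Jcomb.
    by congr comb4; rewrite /mu2 /mu1; field; rewrite ?q0 ?pp.
have [[w2 w3]|[p0 q1]] := frame_dichotomy.
  left; exists (- omega e0 e1).
    rewrite oppr_eq0; apply/eqP => w1; apply: frame_primitive_neq0 => y.
    rewrite (simple_frame_comb eF y) /comb4 !linearDr !linearZr_LR /= w0.
    by rewrite w1 w2 w3 !mulr0 !addr0.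
  move=> x y; rewrite /wedge11 !(add_lfunE, opp_lfunE) !dual_basisE.
  rewrite {1}(coord4 YB x) {1}(coord4 YB y) !combE.
  rewrite (alternating_comb4 e0 e1 e2 e3 w0) w12 w13 w23 w2 w3 kN.
  ring.
right; split.
  by rewrite /mu2 /mu1 p0 q1 mul0r expr0n addr0 divr1.
exists (omega e0 h), (omega e0 ep), (omega e0 em).
set Y := [tuple e0; h; ep; em] in lD YB *.
pose phi := omega e0 h *: dual_basis Y 1 + omega e0 ep *: dual_basis Y 2
  + omega e0 em *: dual_basis Y 3.
have phiE x : phi x = omega e0 x.
  rewrite {2}(coord4 YB x) !linearDr !linearZr_LR /= w0.
  rewrite !add_lfunE !scale_lfunE !dual_basisE /=.
  by rewrite mulr0 add0r; congr (_ + _ + _); apply: mulrC.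
split; last exact: (frame_primitive_form (phi := phi) lD phiE).
rewrite ahE apE amE; apply/eqP => disc; apply: frame_primitive_neq0 => y.
have [[_ nd _ _] _ _] := wJ.
have /nd x0 : forall z, omega
    (comb4 e0 e1 e2 e3 0 (omega e0 e1) (- omega e0 e2) (- omega e0 e3)) z = 0.
  move=> z; rewrite (simple_frame_comb eF z).
  rewrite (alternating_comb4 e0 e1 e2 e3 w0) w12 w13 w23 kN.
  set c := coord _ 0 z; transitivity (c * (4^-1 * ((2 * omega e0 e2) ^+ 2 +
    4 * (- omega e0 e1 - omega e0 e3) * (omega e0 e1 - omega e0 e3)))); first by field.
  by rewrite disc !mulr0.
have : comb4 e0 e1 e2 e3 0 (omega e0 e1) (- omega e0 e2) (- omega e0 e3) =
    comb4 e0 e1 e2 e3 0 0 0 0 by rewrite x0 /comb4 !scale0r !addr0.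
move=> /(coord4_inj XB) [_ w1 /eqP w2 /eqP w3].
rewrite (simple_frame_comb eF y) /comb4 !linearDr !linearZr_LR /= w0 w1.
rewrite oppr_eq0 in w2; rewrite oppr_eq0 in w3.
by rewrite (eqP w2) (eqP w3) !mulr0 !addr0.
Qed.
End NormalForms.

(** * Structures that are not of Vaisman type *)

(** Since the torsion vanishes and [xi] is parallel, [lie xi] is the covariant
    derivative along [xi], and the connection is metric. *)
Lemma vaisman_skew (R : realFieldType) (g : lieAlgType R)
    (w : {biscalar g}) (K : 'End(g)) (l : 'Hom(g, R^o)) :
  lcpk w K l -> vaisman w K l ->
  exists2 xi, lee_field (metric w K) l xi & forall x, metric w K (lie xi x) x = 0.
Proof.
move=> [[w0 _ _ _] _ sk] [nabla [xi [[tor met] lee par]]]; exists xi => // x.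
have wC := alternatingC w0.
have lE : lie xi x = nabla xi x by rewrite -tor par subr0.
have := met xi x x; rewrite lE /metric.
rewrite (wC x) sk opprK -mulr2n => /eqP; rewrite mulrn_eq0 /= => /eqP.
by [].
Qed.

Section ExampleStructure.
Variables (R : realType) (g : lieAlgType R) (X : 4.-tuple g) (k p : R).

(** In coordinates, the form [E0 /\ phi + d phi] with [phi = p E1 + E3]. *)
Definition example_form (x y : g) : R :=
  let c i := coord X i x in let d i := coord X i y in
  p * (c 0 * d 1 - c 1 * d 0) + (c 0 * d 3 - c 3 * d 0)
  + (c 1 * d 2 - c 2 * d 1) + k * p * (c 2 * d 3 - c 3 * d 2).

Lemma example_form_bilinear : bilinear_for *%R *%R example_form.
Proof. by split=> x a y z; rewrite /example_form !linearP /=; ring. Qed.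

HB.instance Definition _ :=
  bilinear_isBilinear.Build R g g R *%R *%R example_form example_form_bilinear.

(** The complex structure of the normal forms with [(p, q) = (0, 1)]. By
    [frame_dichotomy] every other one requires [phi] to be a multiple of [E1],
    and then the Lee field is parallel. *)
Definition example_rotation (x : g) : g :=
  comb4 X`_0 X`_1 X`_2 X`_3
    (- coord X 1 x) (coord X 0 x) (coord X 3 x) (- coord X 2 x).

Lemma example_rotation_linear : linear example_rotation.
Proof.
move=> a x y; rewrite /example_rotation !linearP /= comb4Z comb4D.
by congr comb4; ring.
Qed.

HB.instance Definition _ :=
  GRing.isLinear.Build R g g _ example_rotation example_rotation_linear.
End ExampleStructure.

Section ExampleProperties.
Variables (R : realType) (g : lieAlgType R) (e0 e1 e2 e3 : g) (k p : R).
Hypothesis eF : simple_frame k e0 e1 e2 e3.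
Let X := [tuple e0; e1; e2; e3].
Let omega := example_form X k p : {biscalar g}.
Let J : 'End(g) := linfun (example_rotation X).
Let lambda : 'Hom(g, R^o) := - dual_basis X 0.
Let XB := simple_frame_basis eF.

Let cJ x : [/\ coord X 0 (J x) = - coord X 1 x, coord X 1 (J x) = coord X 0 x,
  coord X 2 (J x) = coord X 3 x & coord X 3 (J x) = - coord X 2 x].
Proof. by rewrite lfunE; apply: (coord4E XB). Qed.

Let cL x y : [/\ coord X 0 (lie x y) = 0,
  coord X 1 (lie x y) =
    k * (coord X 3 x * coord X 2 y - coord X 2 x * coord X 3 y),
  coord X 2 (lie x y) = coord X 1 x * coord X 3 y - coord X 3 x * coord X 1 y &
  coord X 3 (lie x y) = coord X 2 x * coord X 1 y - coord X 1 x * coord X 2 y].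
Proof.
have := simple_frame_lie eF (coord X 0 x) (coord X 1 x) (coord X 2 x)
  (coord X 3 x) (coord X 0 y) (coord X 1 y) (coord X 2 y) (coord X 3 y).
by rewrite -!(simple_frame_comb eF) => ->; apply: (coord4E XB).
Qed.

Let ext x y : coord X 0 x = coord X 0 y -> coord X 1 x = coord X 1 y ->
  coord X 2 x = coord X 2 y -> coord X 3 x = coord X 3 y -> x = y.
Proof.
rewrite [in RHS]/X => h0 h1 h2 h3.
by rewrite (simple_frame_comb eF x) (simple_frame_comb eF y) -/X h0 h1 h2 h3.
Qed.

Let lambdaE x : lambda x = - coord X 0 x.
Proof. by rewrite opp_lfunE dual_basisE. Qed.

Let unit a b c d (x := comb4 e0 e1 e2 e3 a b c d) :
  [/\ coord X 0 x = a, coord X 1 x = b, coord X 2 x = c & coord X 3 x = d].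
Proof. exact: (coord4E XB). Qed.

Hypothesis kp : 1 + k * p ^+ 2 != 0.

Lemma example_proper_lcpk : proper_lcpk omega J lambda.
Proof.
have [u0 u1 u2 u3] := unit 1 0 0 0; have [v0 v1 v2 v3] := unit 0 1 0 0.
have [w0 w1 w2 w3] := unit 0 0 1 0; have [z0 z1 z2 z3] := unit 0 0 0 1.
have dE x y z : d2 omega x y z = wedge12 lambda omega x y z.
  rewrite /d2 /wedge12 !lambdaE /omega /= /example_form.
  have [-> -> -> ->] := cL x y; have [-> -> -> ->] := cL y z.
  by have [-> -> -> ->] := cL z x; ring.
split; first (split; [split|split|]).
- by move=> x; rewrite /omega /= /example_form; ring.
- move=> x x0; have := x0 (comb4 e0 e1 e2 e3 1 0 0 0).
  have := x0 (comb4 e0 e1 e2 e3 0 1 0 0); have := x0 (comb4 e0 e1 e2 e3 0 0 1 0).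
  have := x0 (comb4 e0 e1 e2 e3 0 0 0 1); rewrite /omega /= /example_form.
  rewrite u0 u1 u2 u3 v0 v1 v2 v3 w0 w1 w2 w3 z0 z1 z2 z3.
  set a := coord X 0 x; set b := coord X 1 x; set c := coord X 2 x.
  set d := coord X 3 x => h3 h2 h1 h0.
  have a0 : a = 0.
    apply: (mulfI kp); rewrite mulr0.
    transitivity (a + k * p * c + k * p * (p * a - c)); first by ring.
    have -> : a + k * p * c = 0 by rewrite -h3; ring.
    by have -> : p * a - c = 0; [rewrite -h1; ring|rewrite mulr0 addr0].
  have b0 : b = 0.
    apply: (mulfI kp); rewrite mulr0.
    transitivity (b - k * p * d + k * p * (p * b + d)); first by ring.
    have -> : b - k * p * d = 0 by rewrite -h2; ring.
    have -> : p * b + d = 0 by apply: oppr_inj; rewrite oppr0 -h0; ring.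
    by rewrite mulr0 addr0.
  have c0 : c = 0 by move: h1; rewrite a0 b0; lra.
  have d0 : d = 0 by move: h0; rewrite a0 b0; lra.
  by apply: ext; rewrite ?raddf0.
- by move=> x y; rewrite /d1 lambdaE; have [-> _ _ _] := cL x y; rewrite !oppr0.
- exact: dE.
- move=> x; have [h0 h1 h2 h3] := cJ (J x); have [i0 i1 i2 i3] := cJ x.
  by apply: ext; rewrite ?(h0, h1, h2, h3) ?(i0, i1, i2, i3) raddfN.
- move=> x y.
  have [h0 h1 h2 h3] := cJ (lie (J x) y); have [i0 i1 i2 i3] := cJ (lie x (J y)).
  have [j0 j1 j2 j3] := cL (J x) (J y); have [l0 l1 l2 l3] := cL x y.
  have [m0 m1 m2 m3] := cL (J x) y; have [n0 n1 n2 n3] := cL x (J y).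
  have [q0 q1 q2 q3] := cJ x; have [r0 r1 r2 r3] := cJ y.
  apply: ext; rewrite !raddfB /= raddf0.
  + by rewrite h0 i0 j0 l0 m1 n1 q2 q3 r2 r3; ring.
  + by rewrite h1 i1 j1 l1 m0 n0 q2 q3 r2 r3; ring.
  + by rewrite h2 i2 j2 l2 m3 n3 q1 q2 q3 r1 r2 r3; ring.
  + by rewrite h3 i3 j3 l3 m2 n2 q1 q2 q3 r1 r2 r3; ring.
- move=> x y; rewrite /omega /= /example_form.
  by have [-> -> -> ->] := cJ x; have [-> -> -> ->] := cJ y; ring.
exists (comb4 e0 e1 e2 e3 1 0 0 0), (comb4 e0 e1 e2 e3 0 1 0 0),
  (comb4 e0 e1 e2 e3 0 0 1 0).
rewrite dE /wedge12 !lambdaE /omega /= /example_form.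
rewrite u0 u1 u2 u3 v0 v1 v2 v3 w0 w1 w2 w3 => h.
suff /eqP : (1 : R) = 0 by rewrite oner_eq0.
by apply: oppr_inj; rewrite oppr0 -h; ring.
Qed.

(** The equations for the Lee field exclude that its [e2]-component vanishes,
    whereas [vaisman_skew] at [e1] says that it does. *)
Lemma example_not_vaisman : ~ vaisman omega J lambda.
Proof.
have [lc _] := example_proper_lcpk.
have [u0 u1 u2 u3] := unit 1 0 0 0; have [v0 v1 v2 v3] := unit 0 1 0 0.
have [w0 w1 w2 w3] := unit 0 0 1 0.
move=> /(vaisman_skew lc) [xi lee sk].
have := sk (comb4 e0 e1 e2 e3 0 1 0 0).
have := lee (comb4 e0 e1 e2 e3 1 0 0 0); have := lee (comb4 e0 e1 e2 e3 0 0 1 0).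
rewrite /metric !lambdaE /omega /= /example_form.
have [-> -> -> ->] := cJ (comb4 e0 e1 e2 e3 1 0 0 0).
have [-> -> -> ->] := cJ (comb4 e0 e1 e2 e3 0 1 0 0).
have [-> -> -> ->] := cJ (comb4 e0 e1 e2 e3 0 0 1 0).
have [-> -> -> ->] := cL xi (comb4 e0 e1 e2 e3 0 1 0 0).
rewrite u0 u1 u2 u3 v0 v1 v2 v3 w0 w1 w2 w3.
set a := coord X 0 xi; set c := coord X 2 xi => h2 h0 h1.
have c0 : c = 0 by rewrite -h1; ring.
have a0 : a = 0 by move: h2; rewrite c0; lra.
by move: h0; rewrite a0 c0; lra.
Qed.

End ExampleProperties.

Lemma example_positive_definite (R : realType) (g : lieAlgType R)
    (e0 e1 e2 e3 : g) : simple_frame (-1) e0 e1 e2 e3 ->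
  positive_definite (metric (example_form [tuple e0; e1; e2; e3] (-1) 2)
    (linfun (example_rotation [tuple e0; e1; e2; e3]))).
Proof.
move=> eF x x0; rewrite /metric /= /example_form lfunE /= /example_rotation.
have XB := simple_frame_basis eF.
set X := [tuple _; _; _; _] in XB *.
have := simple_frame_comb eF x; rewrite -/X.
have [-> -> -> ->] := coord4E XB (- coord X 1 x) (coord X 0 x) (coord X 3 x)
  (- coord X 2 x).
move: (coord X 0 x) (coord X 1 x) (coord X 2 x) (coord X 3 x) => a b c d xE.
(* for [p = 2] and [k = -1] the metric is a sum of squares *)
have sE : 2 * (a * a - b * - b) + (a * - c - d * - b) + (b * d - c * a)
  + -1 * 2 * (c * - c - d * d) =
  a ^+ 2 + b ^+ 2 + c ^+ 2 + d ^+ 2 + (a - c) ^+ 2 + (b + d) ^+ 2 by ring.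
rewrite sE lt0r !addr_ge0 ?sqr_ge0 // andbT; apply: contra x0.
rewrite !paddr_eq0 ?addr_ge0 ?sqr_ge0 // !sqrf_eq0.
move=> /andP [/andP [/andP [/andP [/andP [/eqP a0 /eqP b0] /eqP c0] /eqP d0] _] _].
by rewrite xE a0 b0 c0 d0 /comb4 !scale0r !addr0.
Qed.

(** * The classification *)

Section CentralizerBound.
Variables (F : fieldType) (g : lieAlgType F) (lambda phi : 'Hom(g, F^o)).

Let pair (x : g) : 'rV[F]_2 := \row_j (if j == 0 then lambda x else phi x).

Let pair_linear : linear pair.
Proof.
by move=> a x y; apply/rowP => j; rewrite !mxE; case: ifP; rewrite dualP.
Qed.

HB.instance Definition _ := GRing.isLinear.Build F g 'rV[F]_2 _ pair pair_linear.

(** For [x] commuting with [v], invariance of [B] makes [phi] vanish on the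
    brackets of [x]. So [omega x] only depends on [lambda x] and [phi x], and by
    non-degeneracy these two numbers determine [x]. *)
Lemma centralizer_dim_le2 (omega B : {biscalar g}) (v : g) :
  Defs.nondegenerate omega -> biinvariant_scalar_product B ->
  (forall x y, omega x y = - wedge11 lambda phi x y + d1 phi x y) ->
  (forall x, phi x = B v x) -> (\dim (centralizer v) <= 2)%N.
Proof.
move=> wnd [_ _ Binv] wE phiE.
have <- : \dim (linfun pair @: centralizer v) = \dim (centralizer v).
  apply: limg_dim_eq; apply/eqP; rewrite -subv0; apply/subvP => x.
  rewrite memv_cap !memv_ker !lfunE => /andP [/eqP /= vx /eqP /rowP xp].
  rewrite memv0; apply/eqP/wnd => y.
  have := xp 0; have := xp 1; rewrite !mxE /= => px lx.
  rewrite wE /wedge11 /d1 px lx (phiE (lie x y)).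
  have /eqP := Binv x v y; rewrite [lie x v]lieC vx oppr0 linear0l add0r.
  by move=> /eqP ->; rewrite !mul0r mulr0 subrr oppr0 addr0.
by apply: leq_trans (dimvS (subvf _)) _; rewrite dimvf.
Qed.

End CentralizerBound.

(** The sign [k] of the frame decides between the two algebras, and the
    eigenvalue 2 of some [lie x] shows that they are not isomorphic. *)
Lemma reductive_classification (R : realType) (g : lieAlgType R)
    (omega : {biscalar g}) (J : 'End(g)) (lambda : 'Hom(g, R^o)) :
  proper_lcpk omega J lambda -> reductive g ->
  (lie_isomorphic g (u2 R) \/ lie_isomorphic g 'M[R]_2) /\
  (lie_isomorphic g (u2 R) -> u2_normal_form omega J lambda) /\
  (lie_isomorphic g 'M[R]_2 -> gl2_normal_form omega J lambda).
Proof.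
move=> [wJ dw0] gR; have [wl wc _] := wJ; have [_ _ closed _] := wl.
have [b [cb lb lD dim4]] := lcs_reductive gR wl dw0.
have lDE x : (lambda x == 0) = (x \in derived_algebra g).
  apply/eqP/idP => [/lD //|xD].
  suff : x \in lker lambda by rewrite memv_ker => /eqP.
  apply: (subvP (derived_sub _)) xD => y z.
  by have /eqP := closed y z; rewrite /d1 oppr_eq0 memv_ker.
have [e0 [e1 [e2 [e3 [k [p [q [eF k1 lE q0 JE]]]]]]]] :=
  complex_structure_frame gR wc cb lb lDE dim4.
have [u0 [u1 [u2 [u3 uF]]]] := u2_simple_frame R.
have [m0 [m1 [m2 [m3 mF]]]] := gl2_simple_frame R.
have uE := compact_frame_eigen uF.
have mE := split_frame_eigen mF.
case: k1 => kE; rewrite kE in eF *.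
  split; first by left; apply: simple_frame_isomorphic eF uF.
  split=> [_|gM]; first exact: (u2_frame_normal_form wJ eF lE q0 JE).
  by case: mE; apply/(lie_isomorphic_eigen gM)/(compact_frame_eigen eF).
split; first by right; apply: simple_frame_isomorphic eF mF.
split=> [gU|_]; last exact: (gl2_frame_normal_form wJ eF lE q0 JE).
by case: (split_frame_eigen eF); apply/(lie_isomorphic_eigen gU).
Qed.

Theorem theorem4p15 (R : realType) :
  (forall (g : lieAlgType R) (omega : {biscalar g}) (J : 'End(g))
      (lambda : 'Hom(g, R^o)),
    proper_lcpk omega J lambda ->
    (forall (B : {biscalar g}) (b : g) (phi : 'Hom(g, R^o)) (v : g),
       biinvariant_scalar_product B ->
       (forall x, B b x = lambda x) -> B b b <> 0 ->
       (forall x y, omega x y = - wedge11 lambda phi x y + d1 phi x y) ->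
       (forall x, phi x = B v x) ->
       (\dim (centralizer v) <= 2)%N)
    /\
    (reductive g ->
       (lie_isomorphic g (u2 R) \/ lie_isomorphic g 'M[R]_2) /\
       (lie_isomorphic g (u2 R) -> u2_normal_form omega J lambda) /\
       (lie_isomorphic g 'M[R]_2 -> gl2_normal_form omega J lambda)))
  /\
  (exists (omega : {biscalar (u2 R)}) (J : 'End(u2 R))
      (lambda : 'Hom(u2 R, R^o)),
    proper_lcpk omega J lambda /\ ~ vaisman omega J lambda)
  /\
  (exists (omega : {biscalar 'M[R]_2}) (J : 'End('M[R]_2))
      (lambda : 'Hom('M[R]_2, R^o)),
    proper_lcpk omega J lambda /\ ~ vaisman omega J lambda)
  /\
  (exists (omega : {biscalar 'M[R]_2}) (J : 'End('M[R]_2))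
      (lambda : 'Hom('M[R]_2, R^o)),
    [/\ proper_lcpk omega J lambda, ~ vaisman omega J lambda &
        positive_definite (metric omega J)]).
Proof.
split=> [g omega J lambda wJ|].
  split=> [B b phi v BB _ _ wE phiE|]; last exact: reductive_classification.
  have [[[_ wnd _ _] _ _] _] := wJ.
  exact: centralizer_dim_le2 wnd BB wE phiE.
have [u0 [u1 [u2 [u3 uF]]]] := u2_simple_frame R.
have [m0 [m1 [m2 [m3 mF]]]] := gl2_simple_frame R.
have up : 1 + 1 * 0 ^+ 2 != 0 :> R by rewrite expr0n mulr0 addr0 oner_neq0.
have mp : 1 + -1 * 2 ^+ 2 != 0 :> R.
  by rewrite lt_eqF //; lra.
have mpd := example_positive_definite mF.
have mlc := example_proper_lcpk mF mp; have mnv := example_not_vaisman mF mp.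
split.
  by do 3 eexists; split; [apply: (example_proper_lcpk uF up)
    |apply: (example_not_vaisman uF up)].
by split; do 3 eexists; split; [apply: mlc|apply: mnv|apply: mlc|apply: mnv|].
Qed.
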